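(* There exists an algorithm which, given as input a non-surjective monomorphism $\psi: F(a,b)\to F(a,b)$ of the free group of rank two, outputs the maximal outer fixed points of $\psi$.
   Context: $F(a,b)$ is the free group on the basis $a,b$; $\psi$ is given by the two words $\psi(a),\psi(b)$. Write $[w]$ for the conjugacy class of $w$ in $F(a,b)$ and $g\sim h$ for conjugacy. A word $w$ is a proper power if $w=w_0^p$ for some $w_0\in F(a,b)$ and some integer $p>1$. An outer fixed element of $\psi$ is an element $w\in F(a,b)$ with $\psi(w)\sim w$; it is maximal if it is not a proper power. An outer fixed point of $\psi$ is the conjugacy class $[w]$ of an outer fixed element $w$; a maximal outer fixed point is the conjugacy class of a maximal outer fixed element. Conjugacy classes are stored and output by means of representatives. *)

(* Defs.v *)
From HB Require Import structures.
From mathcomp Require Import all_boot.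
From mathcomp Require Import boolp classical_sets.

Set Implicit Arguments.
Unset Strict Implicit.
Unset Printing Implicit Defensive.

Local Open Scope classical_set_scope.

(* Letters are pairs (generator, inverted): (false, false) is a, (true, false)
   is b, and the second component marks the inverse of the generator. *)
Notation letter := (bool * bool)%type.

Notation word := (seq letter).

Definition letter_inv (x : letter) : letter := (x.1, ~~ x.2).

Definition reduced (w : word) : bool :=
  sorted (fun x y => y != letter_inv x) w.

Definition push (x : letter) (w : word) : word :=
  if w is y :: w' then if y == letter_inv x then w' else x :: w else [:: x].

Definition reduce (w : word) : word := foldr push [::] w.

Lemma letter_invK : involutive letter_inv.
Proof. by case=> g s; rewrite /letter_inv /= negbK. Qed.

Lemma letter_inv_neq x : x != letter_inv x.
Proof. by case: x => [[] []]. Qed.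

Lemma reduced_push x w : reduced w -> reduced (push x w).
Proof.
case: w => [|y w] //= yw; case: ifP => [_|/negbT ynx /=]; last by rewrite ynx.
exact: path_sorted yw.
Qed.

Lemma reduced_foldr_push u w : reduced w -> reduced (foldr push w u).
Proof. by move=> wr; elim: u => //= x u; apply: reduced_push. Qed.

Lemma reduced_reduce w : reduced (reduce w).
Proof. exact: reduced_foldr_push. Qed.

Lemma pushK x w : reduced w -> push x (push (letter_inv x) w) = w.
Proof.
case: w => [|y w] /=; first by rewrite eqxx.
rewrite letter_invK; case: eqP => [-> | _ _] /=; last by rewrite eqxx.
by case: w => [|z w] //= /andP[/negPf ->].
Qed.

Lemma foldr_push_push x s w : reduced s -> reduced w ->
  foldr push w (push x s) = push x (foldr push w s).
Proof.
case: s => [|y s] //= _ wr; case: eqP => [->|//].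
by rewrite pushK // reduced_foldr_push.
Qed.

Lemma foldr_push_reduced s : reduced s -> foldr push [::] s = s.
Proof.
elim: s => //= x s IHs xs; rewrite IHs; last exact: path_sorted xs.
by case: s xs {IHs} => [|y s] //= /andP[/negPf ->].
Qed.

Record F2 : Type := MkF2 { wval :> word; _ : reduced wval }.
HB.instance Definition _ := [isSub for wval].
HB.instance Definition _ := [Countable of F2 by <:].

Lemma wval_inj : injective wval. Proof. exact: val_inj. Qed.

Lemma wvalP (u : F2) : reduced u. Proof. exact: valP u. Qed.

(* The element of F(a,b) represented by a (not necessarily reduced) word. *)
Definition elt (w : word) : F2 := MkF2 (reduced_reduce w).

Definition F2_one : F2 := elt [::].
Definition F2_mul (u v : F2) : F2 := elt (wval u ++ wval v).
Definition F2_inv (u : F2) : F2 := elt (rev (map letter_inv u)).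

Lemma F2_mulE u v : wval (F2_mul u v) = foldr push v u.
Proof. by rewrite /= /reduce foldr_cat foldr_push_reduced ?wvalP. Qed.

Lemma foldr_push_comp s t w : reduced t -> reduced w ->
  foldr push w (foldr push t s) = foldr push (foldr push w t) s.
Proof.
move=> tr wr; elim: s => //= x s IHs.
by rewrite foldr_push_push ?IHs // reduced_foldr_push.
Qed.

Lemma F2_mulA : associative F2_mul.
Proof.
by move=> u v w; apply: wval_inj; rewrite !F2_mulE
  foldr_push_comp ?wvalP.
Qed.

Lemma F2_mul1 : left_id F2_one F2_mul.
Proof. by move=> u; apply: wval_inj; rewrite F2_mulE. Qed.

Lemma F2_mulr1 : right_id F2_one F2_mul.
Proof.
by move=> u; apply: wval_inj; rewrite F2_mulE
  foldr_push_reduced ?wvalP.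
Qed.

Lemma foldr_push_inv s w : reduced w ->
  foldr push w (rev (map letter_inv s) ++ s) = w.
Proof.
elim: s w => [|x s IHs] w wr //=.
rewrite rev_cons cat_rcons foldr_cat /= -{2}[x]letter_invK pushK.
  by rewrite -foldr_cat IHs.
exact: reduced_foldr_push.
Qed.

Lemma F2_mulV : left_inverse F2_one F2_inv F2_mul.
Proof.
move=> u; apply: wval_inj; rewrite F2_mulE /= /reduce.
rewrite foldr_push_comp ?wvalP //=.
rewrite -[X in foldr _ X _]foldr_push_reduced ?wvalP //.
by rewrite -foldr_cat foldr_push_inv.
Qed.

Lemma F2_mulrV : right_inverse F2_one F2_inv F2_mul.
Proof.
move=> u; have VV := F2_mulV (F2_inv u).
by rewrite -[LHS]F2_mul1 -VV -F2_mulA [F2_mul (F2_inv u) _]F2_mulA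
  F2_mulV F2_mul1.
Qed.

HB.instance Definition _ :=
  isGroup.Build F2 F2_mulA F2_mul1 F2_mulr1 F2_mulV F2_mulrV.

Definition gen_a : F2 := elt [:: (false, false)].
Definition gen_b : F2 := elt [:: (true, false)].

Local Open Scope group_scope.

Definition conjugate (g h : F2) : Prop := exists x : F2, h = g ^ x.

Definition conj_class (w : F2) : set F2 := [set h | conjugate w h].

Definition proper_power (w : F2) : Prop :=
  exists (w0 : F2) (p : nat), (1 < p)%N /\ w = w0 ^+ p.

Definition outer_fixed_element (psi : F2 -> F2) (w : F2) : Prop :=
  conjugate (psi w) w.

Definition maximal_outer_fixed_element (psi : F2 -> F2) (w : F2) : Prop :=
  outer_fixed_element psi w /\ ~ proper_power w.

Definition maximal_outer_fixed_points (psi : F2 -> F2) : set (set F2) :=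
  [set C | exists w, maximal_outer_fixed_element psi w /\ C = conj_class w].

Local Close Scope group_scope.

(* Partial recursive functions of n natural-number arguments: zero, successor,
   projections, composition, primitive recursion (on the first argument) and
   unbounded minimization (of the first argument). *)
Inductive murec : nat -> Type :=
| MZero n : murec n
| MSucc : murec 1
| MProj n (i : 'I_n) : murec n
| MComp m n (f : murec m) (g : 'I_m -> murec n) : murec n
| MPrec n (f : murec n) (g : murec n.+2) : murec n.+1
| MMin n (f : murec n.+1) : murec n.

(* [eval f xs y]: f halts on the arguments xs, with result y. *)
Fixpoint eval n (f : murec n) : n.-tuple nat -> nat -> Prop :=
  match f in murec n return n.-tuple nat -> nat -> Prop with
  | MZero _ => fun _ y => y = 0
  | MSucc => fun xs y => y = (thead xs).+1
  | MProj _ i => fun xs y => y = tnth xs i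
  | MComp m _ f g => fun xs y =>
      exists zs : m.-tuple nat,
        (forall i, eval (g i) xs (tnth zs i)) /\ eval f zs y
  | MPrec n f g => fun xs =>
      let xs' : n.-tuple nat := [tuple of behead xs] in
      (fix rec k : nat -> Prop :=
         if k is k'.+1
         then fun y => exists z, rec k' z /\ eval g [tuple of k' :: z :: xs'] y
         else eval f xs') (thead xs)
  | MMin _ f => fun xs y =>
      eval f [tuple of y :: xs] 0 /\
      forall z, z < y -> exists k, eval f [tuple of z :: xs] k.+1
  end.

Lemma eval_functional n (f : murec n) xs y z :
  eval f xs y -> eval f xs z -> y = z.
Proof.
elim: f xs y z => {n} /= [n||n i|m n f IHf g IHg|n f IHf g IHg|n f IHf] xs y z.
- by move=> -> ->.
- by move=> -> ->.
- by move=> -> ->.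
- move=> [us [gu fu]] [vs [gv fv]]; apply: IHf fu _.
  suff -> : us = vs by [].
  by apply: eq_from_tnth => i; apply: IHg (gu i) (gv i).
- elim: (thead xs) y z => [|k IHk] y z; first exact: IHf.
  by move=> [u [ru gu]] [v [rv gv]]; rewrite -(IHk _ _ ru rv) in gv;
    apply: IHg gu gv.
- move=> [fy lty] [fz ltz]; case: (ltngtP y z) => // lt.
  + by have [k fk] := ltz _ lt; have := IHf _ _ _ fy fk.
  + by have [k fk] := lty _ lt; have := IHf _ _ _ fz fk.
Qed.

(* a, a^-1, b, b^-1 are coded by 0, 1, 2, 3. *)
Definition letter_code (x : letter) : nat := x.1.*2 + x.2.

Definition word_code (w : word) : nat := CodeSeq.code (map letter_code w).

Definition words_code (s : seq word) : nat := CodeSeq.code (map word_code s).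

(* Main.v *)
(** Let psi be injective and not surjective, and let w be a cyclically reduced
    outer fixed word. Among the bases (s, t) of F(a,b) one can choose, up to
    conjugation, images psi(s), psi(t) that are read on a theta or barbell graph
    without cancellation. If w is the word W in s and t, then psi(w) is the
    cyclic path W of this graph, which is longer than W, unless W is a power of
    s, t or s t^-1, or psi is surjective. By induction on the length, w is a
    power of a primitive element.

    A primitive cyclic word is monotone: it uses a single sign for each
    generator. Hence the length of w is the l^1-norm of its exponent vector,
    which psi^ab fixes. If psi^ab is not the identity, this bounds w by the
    entries of psi^ab. If psi^ab is the identity, either w is one of the short
    loops of the graph, or w = pq for a basis (p, q) such that psi(p) psi(q) is a
    cutting of the cyclic word w into two monotone words with the exponents of p
    and q. Such a cutting is unique up to conjugation, so psi would be inner.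
    Therefore every maximal outer fixed point has a representative of length at
    most |psi(a)| + |psi(b)| + 1, and the algorithm tests all of them. *)
Require Import Defs.
From mathcomp Require Import all_boot all_order ssralg ssrnum ssrint.
From mathcomp Require Import boolp classical_sets zify ring.

Set Implicit Arguments.
Unset Strict Implicit.
Unset Printing Implicit Defensive.

(** * Recursive functions and computable functions on coded types *)

(** The induction on the length changes the map together with the word: a shorter [W] is an outer
    fixed word of [psi] rewritten in the basis (s, t), and this new map is again injective and not
    surjective. Being a power of a primitive element is invariant under such a change of basis,
    whereas a bound on the length is not. Therefore primitivity is settled first, for all maps at
    once, and the bound is derived afterwards from a single normal form of the original [psi], whose
    total length does not exceed |psi(a)| + |psi(b)|. Non-surjectivity enters twice: it excludes a
    theta graph that has degenerated to a rose with two one-letter petals, and it excludes the case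
    where [psi] acts on some basis as a conjugation. The summand 1 of the bound comes from the
    matrix psi^ab - id, whose diagonal entries are exponent sums of psi(a) or psi(b) minus 1. The
    conjugator, the root and the exponent that the tests look for are bounded as well, so the whole
    algorithm consists of folds over finite lists of words. *)

Definition recursive n (f : seq nat -> nat) :=
  exists A : murec n, forall xs : n.-tuple nat, eval A xs (f xs).

Definition recursive1 (f : nat -> nat) := recursive 1 (fun s => f (nth 0 s 0)).
Definition recursive2 (f : nat -> nat -> nat) :=
  recursive 2 (fun s => f (nth 0 s 0) (nth 0 s 1)).
Definition recursive3 (f : nat -> nat -> nat -> nat) :=
  recursive 3 (fun s => f (nth 0 s 0) (nth 0 s 1) (nth 0 s 2)).

Lemma recursive_ext n f g :
  (forall s, f s = g s) -> recursive n f -> recursive n g.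
Proof. by move=> fg [A Af]; exists A => xs; rewrite -fg. Qed.

Lemma recursive_proj n i : i < n -> recursive n (fun s => nth 0 s i).
Proof.
by move=> lt_in; exists (MProj (Ordinal lt_in)) => xs /=; rewrite (tnth_nth 0).
Qed.

Lemma recursive_succ n f : recursive n f -> recursive n (fun s => (f s).+1).
Proof.
move=> [A Af]; exists (MComp MSucc (fun _ => A)) => xs /=.
by exists [tuple f xs]; split=> // i; rewrite ord1.
Qed.

Lemma recursive_cst n k : recursive n (fun _ => k).
Proof.
elim: k => [|k IHk]; last exact: recursive_succ IHk.
by exists (MZero n).
Qed.

Lemma recursive_comp1 n f g :
  recursive1 f -> recursive n g -> recursive n (fun s => f (g s)).
Proof.
move=> [A Af] [B Bg]; exists (MComp A (fun _ => B)) => xs /=.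
exists [tuple g xs]; split; last exact: Af.
by move=> i; rewrite ord1.
Qed.

Lemma recursive_comp2 n f g h : recursive2 f ->
  recursive n g -> recursive n h -> recursive n (fun s => f (g s) (h s)).
Proof.
move=> [A Af] [B Bg] [C Ch].
exists (MComp A (fun i => nth B [:: B; C] i)) => xs /=.
exists [tuple g xs; h xs]; split; last exact: Af.
by case=> [[|[|//]] ?] /=; rewrite (tnth_nth 0).
Qed.

Lemma recursive_comp3 n f g h k : recursive3 f ->
  recursive n g -> recursive n h -> recursive n k ->
  recursive n (fun s => f (g s) (h s) (k s)).
Proof.
move=> [A Af] [B Bg] [C Ch] [D Dk].
exists (MComp A (fun i => nth B [:: B; C; D] i)) => xs /=.
exists [tuple g xs; h xs; k xs]; split; last exact: Af.
by case=> [[|[|[|//]]] ?] /=; rewrite (tnth_nth 0).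
Qed.

Definition primrec (z : nat) (f : nat -> nat -> nat) (n : nat) : nat :=
  nat_rect (fun _ => nat) z f n.

(** A single parameter [k s] suffices: several parameters are packed into one by pairing. *)
Lemma recursive_primrec n f g h :
  recursive1 f -> recursive3 g -> recursive n h -> forall k, recursive n k ->
  recursive n (fun s => primrec (f (k s)) (fun i z => g i z (k s)) (h s)).
Proof.
move=> [A Af] [B Bg] rh k rk.
pose F m p := primrec (f p) (fun i z => g i z p) m.
apply: (@recursive_comp2 n F) => //.
exists (MPrec A B) => xs /=; rewrite /F.
have -> : thead xs = nth 0 xs 0 by rewrite /thead (tnth_nth 0).
elim: (nth 0 xs 0) => [|m IHm] /=.
  by have:= Af [tuple of behead xs]; rewrite /= nth_behead.
exists (F m (nth 0 xs 1)); split; first exact: IHm.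
have:= Bg [tuple of m :: F m (nth 0 xs 1) :: [tuple of behead xs]].
by rewrite /= nth_behead.
Qed.

Lemma recursive1_primrec0 z g : recursive2 g ->
  recursive1 (fun n => primrec z (fun i z => g i z) n).
Proof.
move=> rg; apply: (@recursive_primrec 1 (fun _ => z) (fun i z _ => g i z)
  (fun s => nth 0 s 0) _ _ _ (fun _ => 0)).
- exact: recursive_cst.
- by apply: recursive_comp2 => //; exact: recursive_proj.
- exact: recursive_proj.
- exact: recursive_cst.
Qed.

Lemma recursive2_primrec f g : recursive1 f -> recursive3 g ->
  recursive2 (fun n p => primrec (f p) (fun i z => g i z p) n).
Proof.
move=> rf rg; apply: (@recursive_primrec 2 f g (fun s => nth 0 s 0) rf rg _
  (fun s => nth 0 s 1)); exact: recursive_proj.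
Qed.

Lemma recursive1_id : recursive1 id. Proof. exact: recursive_proj. Qed.

Lemma recursive2_add : recursive2 addn.
Proof.
apply: (recursive_ext (f := fun s => primrec (nth 0 s 1) (fun i z => z.+1)
  (nth 0 s 0))) => [s|]; first by elim: (nth 0 s 0) => //= n ->.
apply: (@recursive2_primrec id (fun _ z _ => z.+1)); first exact: recursive1_id.
by apply: recursive_succ; exact: recursive_proj.
Qed.

Lemma recursive_add n f g : recursive n f -> recursive n g ->
  recursive n (fun s => f s + g s).
Proof. exact: recursive_comp2 recursive2_add. Qed.

Lemma recursive_double n f : recursive n f -> recursive n (fun s => (f s).*2).
Proof.
move=> rf; apply: (recursive_ext (f := fun s => f s + f s)) => [s|].
  by rewrite addnn.
exact: recursive_add.
Qed.

Lemma recursive2_cons : recursive2 (fun n m => 2 ^ n * m.*2.+1).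
Proof.
apply: (recursive_ext (f := fun s => primrec (nth 0 s 1).*2.+1
  (fun i z => z.*2) (nth 0 s 0))) => [s|].
  elim: (nth 0 s 0) => [|n /= ->]; first by rewrite mul1n.
  by rewrite expnS -mulnA mul2n.
apply: (@recursive2_primrec (fun p => p.*2.+1) (fun _ z _ => z.*2)).
  by apply: recursive_succ; apply: recursive_double; exact: recursive_proj.
by apply: recursive_double; exact: recursive_proj.
Qed.

Definition ifn (c x y : nat) := if c is 0 then y else x.

Lemma recursive_ifn n f g h : recursive n f -> recursive n g -> recursive n h ->
  recursive n (fun s => ifn (f s) (g s) (h s)).
Proof.
move=> rf rg rh; apply: (@recursive_comp3 n ifn) => //.
(* A recursion that ignores its accumulator is a case split on zero: [K] keeps [y] at 0, [L] keeps
   [x] elsewhere, and their sum is [ifn]. *)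
pose K c y := primrec y (fun _ _ => 0) c.
pose L c x := primrec 0 (fun _ _ => x) c.
have rK : recursive2 K.
  by apply: (@recursive2_primrec id (fun _ _ _ => 0)); [exact: recursive1_id |
    exact: recursive_cst].
have rL : recursive2 L.
  by apply: (@recursive2_primrec (fun=> 0) (fun _ _ x => x));
    [exact: recursive_cst | exact: recursive_proj].
apply: (recursive_ext (f := fun s => L (nth 0 s 0) (nth 0 s 1) +
   K (nth 0 s 0) (nth 0 s 2))) => [s|].
  by case: (nth 0 s 0) => [|?] //=; rewrite addn0.
apply: recursive_add; [apply: (recursive_comp2 rL) | apply: (recursive_comp2 rK)];
  exact: recursive_proj.
Qed.

Lemma recursive_pred n f : recursive n f -> recursive n (fun s => (f s).-1).
Proof.
apply: (@recursive_comp1 n predn).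
apply: (recursive_ext (f := fun s => primrec 0 (fun i _ => i) (nth 0 s 0))).
  by move=> s; case: (nth 0 s 0).
by apply: (@recursive1_primrec0 0 (fun i _ => i)); exact: recursive_proj.
Qed.

Lemma recursive_sub n f g : recursive n f -> recursive n g ->
  recursive n (fun s => f s - g s).
Proof.
move=> rf rg; apply: (@recursive_comp2 n (fun x y => y - x) _ _ _ rg rf).
apply: (recursive_ext (f := fun s => primrec (nth 0 s 1) (fun _ z => z.-1)
  (nth 0 s 0))).
  by move=> s; elim: (nth 0 s 0) => [|m /= ->]; rewrite ?subn0 ?subnS.
apply: (@recursive2_primrec id (fun _ z _ => z.-1)); first exact: recursive1_id.
by apply: recursive_pred; exact: recursive_proj.
Qed.

Lemma recursive_odd n f :
  recursive n f -> recursive n (fun s => odd (f s) : nat).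
Proof.
apply: (@recursive_comp1 n (fun m => odd m : nat)).
apply: (recursive_ext (f := fun s => primrec 0 (fun _ z => 1 - z) (nth 0 s 0))).
  by move=> s; elim: (nth 0 s 0) => //= m ->; case: (odd m).
apply: (@recursive1_primrec0 0 (fun _ z => 1 - z)).
by apply: recursive_sub; [exact: recursive_cst | exact: recursive_proj].
Qed.

Lemma recursive_half n f : recursive n f -> recursive n (fun s => (f s)./2).
Proof.
apply: (@recursive_comp1 n half).
apply: (recursive_ext (f := fun s => primrec 0 (fun i z => odd i + z)
  (nth 0 s 0))).
  by move=> s; elim: (nth 0 s 0) => //= m ->; rewrite uphalf_half.
apply: (@recursive1_primrec0 0 (fun i z => odd i + z)).
by apply: recursive_add; [apply: recursive_odd|]; exact: recursive_proj.
Qed.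

(* The code of x :: s is 2 ^ x * (2 * code s + 1): the tail is read off its odd
   part, and the head is the number of halvings needed to reach it. *)
Definition odd_step c := ifn (odd c) c c./2.
Definition code_behead c := (primrec c (fun _ => odd_step) c)./2.
Definition code_head c :=
  primrec 0 (fun i z => z + (1 - odd (primrec c (fun _ => odd_step) i))) c.

(** Odd numbers are fixed by [odd_step], so the exponent of 2 decreases to 0 and stays there, as
    truncated subtraction does. *)
Lemma iter_odd_step x m i :
  primrec (2 ^ x * m.*2.+1) (fun _ => odd_step) i = 2 ^ (x - i) * m.*2.+1.
Proof.
elim: i => [|i /= ->]; first by rewrite subn0.
rewrite subnS /odd_step; case: (x - i) => [|j].
  by rewrite expn0 !mul1n /= odd_double.
by rewrite oddM oddX /= [2 ^ j.+1]expnS -mulnA mul2n doubleK.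
Qed.

Lemma code_beheadK x m : code_behead (2 ^ x * m.*2.+1) = m.
Proof.
rewrite /code_behead iter_odd_step.
(* As many iterations as the code itself are enough, because x < 2 ^ x. *)
have -> : x - 2 ^ x * m.*2.+1 = 0.
  apply/eqP; rewrite subn_eq0 (leq_trans (ltnW (ltn_expl x (ltnSn 1)))) //.
  by rewrite leq_pmulr.
by rewrite mul1n /= uphalf_double.
Qed.

Lemma code_headK x m : code_head (2 ^ x * m.*2.+1) = x.
Proof.
rewrite /code_head; set c := 2 ^ x * _.
have: forall n, primrec 0 (fun i z => z + (1 - odd (primrec c (fun _ => odd_step) i))) n
  = minn n x.
  elim=> [|n /= ->]; first by rewrite min0n.
  rewrite iter_odd_step oddM /= odd_double andbT oddX /= orbF subn_eq0.
  by case: leqP => xn /=; lia.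
move->; apply/minn_idPr; rewrite (leq_trans (ltnW (ltn_expl x (ltnSn 1)))) //.
by rewrite leq_pmulr.
Qed.

Lemma recursive_odd_step n f :
  recursive n f -> recursive n (fun s => odd_step (f s)).
Proof.
by move=> rf; apply: recursive_ifn; [apply: recursive_odd| |
  apply: recursive_half].
Qed.

Lemma recursive2_iter f : recursive1 f ->
  recursive2 (fun i c => primrec c (fun _ => f) i).
Proof.
move=> rf; apply: (@recursive2_primrec id (fun _ z _ => f z)).
  exact: recursive1_id.
by apply: (recursive_comp1 rf); exact: recursive_proj.
Qed.

Lemma recursive_code_behead : recursive1 code_behead.
Proof.
apply: recursive_half; apply: (recursive_comp2 (f := fun i c => primrec c (fun _ => odd_step) i)).
- apply: recursive2_iter; apply: recursive_odd_step; exact: recursive_proj.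
- exact: recursive_proj.
- exact: recursive_proj.
Qed.

Lemma recursive_code_head : recursive1 code_head.
Proof.
apply: (@recursive_primrec 1 (fun=> 0) (fun i z c => z +
  (1 - odd (primrec c (fun _ => odd_step) i))) _ _ _ _ (fun s => nth 0 s 0)).
- exact: recursive_cst.
- apply: recursive_add; first exact: recursive_proj.
  apply: recursive_sub; first exact: recursive_cst.
  apply: recursive_odd; apply: (recursive_comp2 (f := fun i c =>
    primrec c (fun _ => odd_step) i)); try exact: recursive_proj.
  by apply: recursive2_iter; apply: recursive_odd_step; exact: recursive_proj.
- exact: recursive_proj.
- exact: recursive_proj.
Qed.

(* The fold runs from the end of the list: at stage k it treats the tail
   obtained by dropping c - k.+1 items, which is 0 past the end. *)
Definition code_foldr (f : nat -> nat -> nat) (z c : nat) :=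
  primrec z (fun k acc =>
    let t := primrec c (fun _ => code_behead) (c - k.+1) in
    ifn t (f (code_head t) acc) acc) c.

Lemma iter_code_behead s i :
  primrec (CodeSeq.code s) (fun _ => code_behead) i = CodeSeq.code (drop i s).
Proof.
elim: i => [|i /= ->]; first by rewrite drop0.
elim: s i => [|x s IHs] [|i] //=; first by rewrite code_beheadK drop0.
Qed.

(** This lets the code of a list serve as the number of stages in [code_foldr]. *)
Lemma size_code s : size s <= CodeSeq.code s.
Proof.
elim: s => //= x s IHs; rewrite (@leq_trans (CodeSeq.code s).*2.+1) //.
  by rewrite ltnS (leq_trans IHs) // -addnn leq_addr.
by rewrite leq_pmull // expn_gt0.
Qed.

Lemma code_foldrE f z s : code_foldr f z (CodeSeq.code s) = foldr f z s.
Proof.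
rewrite /code_foldr; set c := CodeSeq.code s.
suff H k : k <= c ->
  primrec z (fun k acc =>
    let t := primrec c (fun _ => code_behead) (c - k.+1) in
    ifn t (f (code_head t) acc) acc) k = foldr f z (drop (c - k) s).
  by rewrite H // subnn drop0.
elim: k => [|k IHk] kc /=.
  by rewrite subn0 drop_oversize // size_code.
rewrite IHk ?(ltnW kc) // iter_code_behead.
have -> : c - k = (c - k.+1).+1 by rewrite subnS prednK // subn_gt0.
case: (ltnP (c - k.+1) (size s)) => lts.
  rewrite (drop_nth 0 lts) /= code_headK.
  by case: (2 ^ _ * _) (muln_gt0 (2 ^ (nth 0 s (c - k.+1)))
    (CodeSeq.code (drop (c - k.+1).+1 s)).*2.+1) => //; rewrite expn_gt0.
by rewrite !drop_oversize //= (leq_trans lts).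
Qed.

(** * Computable functions between coded types *)

Class coded (X : Type) := enc : X -> nat.

Section Computable.
Context {X Y Z T : Type} {cX : coded X} {cY : coded Y} {cZ : coded Z}
  {cT : coded T}.

Definition computable (f : X -> Y) :=
  exists2 g, recursive1 g & forall x, g (enc x) = enc (f x).

(** A pair has the code of a list cell, so [code_head] and [code_behead] decode both pairs and
    lists. *)
#[global] Instance coded_pair : coded (X * Y) :=
  fun p => 2 ^ enc p.1 * (enc p.2).*2.+1.

#[global] Instance coded_seq : coded (seq X) :=
  fun s => CodeSeq.code (map enc s).

End Computable.

#[global] Instance coded_bool : coded bool := nat_of_bool.
#[global] Instance coded_letter : coded letter := letter_code.

Section Combinators.
Context {X Y Z T : Type} {cX : coded X} {cY : coded Y} {cZ : coded Z}
  {cT : coded T}.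

Lemma computable_id : computable (@id X).
Proof. by exists id; first exact: recursive1_id. Qed.

Lemma computable_comp (f : Y -> Z) (g : X -> Y) :
  computable f -> computable g -> computable (fun x => f (g x)).
Proof.
move=> [F rF Ff] [G rG Gg]; exists (fun n => F (G n)); last by move=> x; rewrite Gg.
exact: recursive_comp1 rF rG.
Qed.

Lemma computable_cst (y : Y) : computable (fun _ : X => y).
Proof. by exists (fun _ => enc y) => //; exact: recursive_cst. Qed.

Lemma computable_pair (f : X -> Y) (g : X -> Z) :
  computable f -> computable g -> computable (fun x => (f x, g x)).
Proof.
move=> [F rF Ff] [G rG Gg]; exists (fun n => 2 ^ F n * (G n).*2.+1).
  exact: recursive_comp2 recursive2_cons rF rG.
by move=> x; rewrite Ff Gg.
Qed.

Lemma computable_fst : computable (@fst X Y).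
Proof.
by exists code_head => [|x]; [exact: recursive_code_head | exact: code_headK].
Qed.

Lemma computable_snd : computable (@snd X Y).
Proof.
by exists code_behead => [|x]; [exact: recursive_code_behead | exact: code_beheadK].
Qed.

Lemma computable_cons (f : X -> Y) (g : X -> seq Y) :
  computable f -> computable g -> computable (fun x => f x :: g x).
Proof.
move=> [F rF Ff] [G rG Gg]; exists (fun n => 2 ^ F n * (G n).*2.+1).
  exact: recursive_comp2 recursive2_cons rF rG.
by move=> x; rewrite Ff Gg.
Qed.

Lemma computable_if (b : X -> bool) (f g : X -> Y) :
  computable b -> computable f -> computable g ->
  computable (fun x => if b x then f x else g x).
Proof.
move=> [B rB Bb] [F rF Ff] [G rG Gg]; exists (fun n => ifn (B n) (F n) (G n)).
  exact: recursive_ifn.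
by move=> x; rewrite Bb Ff Gg /enc /coded_bool; case: (b x).
Qed.

(** This is the recursion scheme behind the algorithm: maps, filters, reversal, free reduction and
    the enumeration of words are all folds. *)
Lemma computable_foldr (f : X -> seq Y) (z : X -> Z) (g : Y * Z * X -> Z) :
  computable f -> computable z -> computable g ->
  computable (fun x => foldr (fun y acc => g (y, acc, x)) (z x) (f x)).
Proof.
move=> [F rF Ff] [U rU Uz] [G rG Gg].
pose H y acc x := G (2 ^ (2 ^ y * acc.*2.+1) * x.*2.+1).
exists (fun n => code_foldr (fun y acc => H y acc n) (U n) (F n)).
  (* [recursive_primrec] has one parameter, so the code of the list and the input are packed into
     [p]. *)
  pose K k acc p := let: n := code_behead p in let: c := code_head p in
    let t := primrec c (fun _ => code_behead) (c - k.+1) in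
    ifn t (H (code_head t) acc n) acc.
  have rH : recursive3 H.
    apply: (recursive_comp1 rG); apply: (recursive_comp2 recursive2_cons).
      by apply: (recursive_comp2 recursive2_cons); exact: recursive_proj.
    exact: recursive_proj.
  have rK : recursive3 K.
    have rt : recursive 3 (fun s => let: c := code_head (nth 0 s 2) in
      primrec c (fun _ => code_behead) (c - (nth 0 s 0).+1)).
      have rc : recursive 3 (fun s => code_head (nth 0 s 2)).
        by apply: (recursive_comp1 recursive_code_head); exact: recursive_proj.
      apply: (recursive_comp2 (f := fun i c => primrec c (fun _ => code_behead) i)) => //.
        exact: recursive2_iter recursive_code_behead.
      by apply: recursive_sub => //; apply: recursive_succ; exact: recursive_proj.
    apply: recursive_ifn => //; last exact: recursive_proj.
    apply: (recursive_comp3 rH); last 1 first.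
    - by apply: (recursive_comp1 recursive_code_behead); exact: recursive_proj.
    - exact: (recursive_comp1 recursive_code_head rt).
    - exact: recursive_proj.
  apply: (recursive_ext (f := fun s =>
    let: p := 2 ^ (F (nth 0 s 0)) * (nth 0 s 0).*2.+1 in
    primrec (U (code_behead p)) (fun k acc => K k acc p) (F (nth 0 s 0)))) => [s|].
    by rewrite /K code_beheadK code_headK.
  apply: (@recursive_primrec 1 (fun p => U (code_behead p)) K) => //.
    apply: (recursive_comp1 rU); apply: (recursive_comp1 recursive_code_behead).
    exact: recursive_proj.
  by apply: (recursive_comp2 recursive2_cons) => //; exact: recursive_proj.
move=> x; rewrite Ff code_foldrE foldr_map Uz.
by elim: (f x) => //= y s ->; exact: (Gg (y, _, x)).
Qed.

End Combinators.

(** * The algorithm *)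

Section PairProjections.
Context {X Y Z : Type} {cX : coded X} {cY : coded Y} {cZ : coded Z}.

Lemma computable_fstf (f : X -> Y * Z) :
  computable f -> computable (fun x => (f x).1).
Proof. exact: computable_comp (@computable_fst _ _ _ _). Qed.

Lemma computable_sndf (f : X -> Y * Z) :
  computable f -> computable (fun x => (f x).2).
Proof. exact: computable_comp (@computable_snd _ _ _ _). Qed.

End PairProjections.

Section ListFolds.
Context {X Y Z : Type} {cX : coded X} {cY : coded Y} {cZ : coded Z}.

Lemma computable_map (f : X -> seq Y) (h : Y * X -> Z) :
  computable f -> computable h ->
  computable (fun x => [seq h (y, x) | y <- f x]).
Proof.
move=> cf ch; apply: (computable_foldr (z := fun=> [::])
  (g := fun p => h (p.1.1, p.2) :: p.1.2)) => //; first exact: computable_cst.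
have c1 := computable_fstf (@computable_fst (Y * seq Z)%type X _ _).
have c2 := computable_sndf (@computable_fst (Y * seq Z)%type X _ _).
apply: computable_cons => //; apply: (computable_comp ch).
by apply: computable_pair => //; exact: computable_snd.
Qed.

Lemma computable_cat (f g : X -> seq Y) :
  computable f -> computable g -> computable (fun x => f x ++ g x).
Proof.
move=> cf cg; have: computable (fun x =>
    foldr (fun y acc => (fun p : Y * seq Y * X => p.1.1 :: p.1.2) (y, acc, x))
    (g x) (f x)).
  apply: (computable_foldr (g := fun p : Y * seq Y * X => p.1.1 :: p.1.2)) => //.
  apply: computable_cons.
    exact: computable_fstf (@computable_fst (Y * seq Y)%type X _ _).
  exact: computable_sndf (@computable_fst (Y * seq Y)%type X _ _).
by congr computable; apply: functional_extensionality_dep => x; elim: (f x) => //= ? ? ->.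
Qed.

Lemma computable_has (f : X -> seq Y) (h : Y * X -> bool) :
  computable f -> computable h ->
  computable (fun x => has (fun y => h (y, x)) (f x)).
Proof.
move=> cf ch; have: computable (fun x =>
    foldr (fun y acc => (fun p : Y * bool * X =>
      if h (p.1.1, p.2) then true else p.1.2) (y, acc, x)) false (f x)).
  apply: (computable_foldr (z := fun=> false) (g := fun p : Y * bool * X =>
      if h (p.1.1, p.2) then true else p.1.2)) => //.
    exact: computable_cst.
  apply: computable_if.
  - apply: (computable_comp ch); apply: computable_pair; last exact: computable_snd.
    exact: computable_fstf (@computable_fst (Y * bool)%type X _ _).
  - exact: computable_cst.
  - exact: computable_sndf (@computable_fst (Y * bool)%type X _ _).
by congr computable.
Qed.

Lemma computable_filter (f : X -> seq Y) (h : Y * X -> bool) :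
  computable f -> computable h ->
  computable (fun x => [seq y <- f x | h (y, x)]).
Proof.
move=> cf ch; have c1 := computable_fstf (@computable_fst (Y * seq Y)%type X _ _).
have c2 := computable_sndf (@computable_fst (Y * seq Y)%type X _ _).
apply: (computable_foldr (z := fun=> [::]) (g := fun p : Y * seq Y * X =>
      if h (p.1.1, p.2) then p.1.1 :: p.1.2 else p.1.2)) => //.
  exact: computable_cst.
apply: computable_if => //; last exact: computable_cons.
apply: (computable_comp ch); apply: computable_pair => //; exact: computable_snd.
Qed.

Lemma computable_behead (f : X -> seq Y) :
  computable f -> computable (fun x => behead (f x)).
Proof.
move=> [F rF Ff]; exists (fun n => code_behead (F n)).
  exact: recursive_comp1 recursive_code_behead rF.
move=> x; rewrite Ff /enc /coded_seq; case: (f x) => //= y s.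
exact: code_beheadK.
Qed.

Lemma computable_head (y0 : Y) (f : X -> seq Y) :
  computable f -> computable (fun x => head y0 (f x)).
Proof.
move=> [F rF Ff]; exists (fun n => ifn (F n) (code_head (F n)) (enc y0)).
  apply: recursive_ifn => //; last exact: recursive_cst.
  exact: recursive_comp1 recursive_code_head rF.
move=> x; rewrite Ff {1 2}/enc /coded_seq; case: (f x) => //= y s.
by rewrite code_headK -[2 ^ _ * _]prednK // muln_gt0 expn_gt0.
Qed.

End ListFolds.

Section ListReversal.
Context {X Y Z : Type} {cX : coded X} {cY : coded Y} {cZ : coded Z}.

Lemma computable_rev (f : X -> seq Y) :
  computable f -> computable (fun x => rev (f x)).
Proof.
move=> cf; have: computable (fun x =>
    foldr (fun y acc => (fun p : Y * seq Y * X => p.1.2 ++ [:: p.1.1]) (y, acc, x))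
    [::] (f x)).
  apply: (computable_foldr (z := fun=> [::])
    (g := fun p : Y * seq Y * X => p.1.2 ++ [:: p.1.1])) => //.
    exact: computable_cst.
  apply: computable_cat.
    exact: computable_sndf (@computable_fst (Y * seq Y)%type X _ _).
  apply: computable_cons; last exact: computable_cst.
  exact: computable_fstf (@computable_fst (Y * seq Y)%type X _ _).
congr computable; apply: functional_extensionality_dep => x.
by elim: (f x) => //= y s ->; rewrite rev_cons cats1.
Qed.

Lemma computable_flatten (f : X -> seq (seq Y)) :
  computable f -> computable (fun x => flatten (f x)).
Proof.
move=> cf; have: computable (fun x =>
    foldr (fun y acc => (fun p : seq Y * seq Y * X => p.1.1 ++ p.1.2) (y, acc, x))
    [::] (f x)).
  apply: (computable_foldr (z := fun=> [::])
    (g := fun p : seq Y * seq Y * X => p.1.1 ++ p.1.2)) => //.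
    exact: computable_cst.
  apply: computable_cat.
    exact: computable_fstf (@computable_fst (seq Y * seq Y)%type X _ _).
  exact: computable_sndf (@computable_fst (seq Y * seq Y)%type X _ _).
by congr computable.
Qed.

End ListReversal.

Lemma computable_eq (X : Type) (Y : eqType) (cX : coded X) (cY : coded Y)
    (f g : X -> Y) : injective (enc : Y -> nat) ->
  computable f -> computable g -> computable (fun x => f x == g x).
Proof.
move=> injY [F rF Ff] [G rG Gg].
(* The two truncated differences both vanish exactly when the codes agree. *)
exists (fun n => ifn ((F n - G n) + (G n - F n)) 0 1).
  apply: recursive_ifn; try exact: recursive_cst.
  by apply: recursive_add; apply: recursive_sub.
move=> x; rewrite Ff Gg.
case: (f x =P g x) => [->|fg]; first by rewrite subnn.
have: enc (f x) != enc (g x) by apply/eqP => /injY.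
by move: (enc (f x)) (enc (g x)) => m n; case E: (_ + _) => //=; lia.
Qed.

Lemma letter_code_inj : injective letter_code.
Proof. by case=> [[] []] [[] []]. Qed.

Lemma enc_word_inj : injective (enc : word -> nat).
Proof.
move=> s t /(can_inj CodeSeq.codeK); apply: inj_map; exact: letter_code_inj.
Qed.

Lemma computable_letter (X Y : Type) (cX : coded X) (cY : coded Y)
    (f : X -> letter) (h : letter -> X -> Y) :
  computable f -> (forall l, computable (h l)) -> computable (fun x => h (f x) x).
Proof.
move=> cf ch.
have ceq l : computable (fun x => f x == l).
  by apply: computable_eq letter_code_inj cf _; exact: computable_cst.
have: computable (fun x =>
  if f x == (false, false) then h (false, false) x else
  if f x == (false, true) then h (false, true) x else
  if f x == (true, false) then h (true, false) x else h (true, true) x).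
  by do 3![apply: computable_if => //].
congr computable; apply: functional_extensionality_dep => x.
by case: (f x) => [[] []].
Qed.

Definition letters : seq letter :=
  [:: (false, false); (false, true); (true, false); (true, true)].

(* Natural numbers are represented in unary, by words. *)
Definition words_upto (l : word) : seq word :=
  foldr (fun _ acc => [::] :: flatten [seq [seq x :: w | w <- acc] | x <- letters])
    [:: [::]] l.

Lemma mem_words_upto (l w : word) : (w \in words_upto l) = (size w <= size l).
Proof.
elim: l w => [|y l IHl] [|x w] //.
rewrite inE [_ == _]/= orFb; apply/flatten_mapP/idP => [[z _ /mapP[v]]|].
  by rewrite IHl => vl [_ ->]; rewrite ltnS.
rewrite ltnS -IHl => wl; exists x; first by case: x => [[] []].
by apply/mapP; exists w.
Qed.

Definition inv_word (w : word) : word := rev (map letter_inv w).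

Definition letter_image (u v : word) (x : letter) : word :=
  let y := if x.1 then v else u in if x.2 then inv_word y else y.

Definition subst (u v w : word) : word :=
  flatten [seq letter_image u v x | x <- w].

(** The bound on [x] is large enough for cyclically reduced [w]: the reduced image is then a
    rotation of [w] with a stem at both ends, and the conjugator consists of a piece of [w] and this
    stem. *)
Definition fixed_test (u v w : word) : bool :=
  has (fun x => reduce (inv_word x ++ subst u v w ++ x) == reduce w)
    (words_upto (w ++ reduce (subst u v w))).

(** Only the length of [x] matters: it is the exponent, and [behead x] is empty for exponents 0 and
    1. The two extra letters make exponent 2 available for the empty word, which is its own
    square. *)
Definition power_test (w : word) : bool :=
  let s := words_upto ((false, false) :: (false, false) :: w) in
  has (fun z => has (fun x => if behead x == [::] then false else
    reduce (flatten [seq z | _ <- x]) == reduce w) s) s.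

(** The letter in front of [u ++ v] is the summand 1 of the length bound. A class may be listed
    through several representatives. *)
Definition algorithm (U : seq word) : seq word :=
  let u := head [::] U in let v := head [::] (behead U) in
  [seq w <- words_upto ((false, false) :: u ++ v) |
     if power_test w then false else fixed_test u v w].

Section ComputableAlgorithm.
Context {X : Type} {cX : coded X}.

Lemma computable_inv_word (f : X -> word) :
  computable f -> computable (fun x => inv_word (f x)).
Proof.
move=> cf; apply: computable_rev.
apply: (computable_map (h := fun p => letter_inv p.1)) => //.
apply: (computable_letter (h := fun l _ => letter_inv l)) => [|l].
  exact: computable_fst.
exact: computable_cst.
Qed.

Lemma computable_words_upto (f : X -> word) :
  computable f -> computable (fun x => words_upto (f x)).
Proof.
move=> cf; pose g (p : letter * seq word * X) :=
  [::] :: flatten [seq [seq x :: w | w <- p.1.2] | x <- letters].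
apply: (computable_foldr (z := fun=> [:: [::]]) (g := g)) => //.
  exact: computable_cst.
apply: computable_cons; first exact: computable_cst.
apply: computable_flatten.
apply: (computable_map (f := fun=> letters) (h := fun q =>
  [seq q.1 :: w | w <- q.2.1.2])); first exact: computable_cst.
apply: (computable_map (h := fun r => r.2.1 :: r.1)).
  apply: computable_sndf; apply: computable_fstf; exact: computable_snd.
apply: computable_cons; last exact: computable_fst.
apply: computable_fstf; exact: computable_snd.
Qed.

Lemma computable_reduce (f : X -> word) :
  computable f -> computable (fun x => reduce (f x)).
Proof.
move=> cf; pose g (p : letter * word * X) : word := push p.1.1 p.1.2.
apply: (computable_foldr (z := fun=> [::]) (g := g)) => //; first exact: computable_cst.
have c1 := computable_fstf (@computable_fst (letter * word)%type X _ _).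
have c2 := computable_sndf (@computable_fst (letter * word)%type X _ _).
have: computable (fun p : letter * word * X =>
  if p.1.2 == [::] then [:: p.1.1] else
  if head (false, false) p.1.2 == letter_inv p.1.1 then behead p.1.2 else
    p.1.1 :: p.1.2).
  apply: computable_if; last apply: computable_if.
  - by apply: computable_eq => //; [exact: enc_word_inj | exact: computable_cst].
  - by apply: computable_cons => //; exact: computable_cst.
  - apply: computable_eq; [exact: letter_code_inj | exact: computable_head |].
    apply: (computable_letter (h := fun l _ => letter_inv l)) => // l.
    exact: computable_cst.
  - exact: computable_behead.
  - exact: computable_cons.
congr computable; apply: functional_extensionality_dep => -[[y [|z w]] x] //=.
Qed.

End ComputableAlgorithm.

Section ComputableSubst.
Context {X : Type} {cX : coded X}.

Lemma computable_subst (f g h : X -> word) :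
  computable f -> computable g -> computable h ->
  computable (fun x => subst (f x) (g x) (h x)).
Proof.
move=> cf cg ch; apply: computable_flatten.
apply: (computable_map (h := fun p => letter_image (f p.2) (g p.2) p.1)) => //.
apply: (computable_letter (h := fun l p => letter_image (f p.2) (g p.2) l)).
  exact: computable_fst.
have c2 : computable (@snd letter X) by exact: computable_snd.
have cf2 := computable_comp cf c2.
have cg2 := computable_comp cg c2.
case=> [[] []] //; exact: computable_inv_word.
Qed.

End ComputableSubst.

Section ComputableTests.
Context {X : Type} {cX : coded X}.

Lemma computable_fixed_test (f g h : X -> word) :
  computable f -> computable g -> computable h ->
  computable (fun x => fixed_test (f x) (g x) (h x)).
Proof.
move=> cf cg ch.
apply: (computable_has (h := fun p => reduce (inv_word p.1 ++
  subst (f p.2) (g p.2) (h p.2) ++ p.1) == reduce (h p.2))).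
  apply: computable_words_upto; apply: computable_cat => //.
  by apply: computable_reduce; apply: computable_subst.
have c2 : computable (@snd word X) by exact: computable_snd.
have c1 : computable (@fst word X) by exact: computable_fst.
have cf2 := computable_comp cf c2.
have cg2 := computable_comp cg c2.
have ch2 := computable_comp ch c2.
apply: computable_eq enc_word_inj _ _; last exact: computable_reduce.
apply: computable_reduce; apply: computable_cat; first exact: computable_inv_word.
by apply: computable_cat => //; apply: computable_subst.
Qed.

Lemma computable_power_test (h : X -> word) :
  computable h -> computable (fun x => power_test (h x)).
Proof.
move=> ch.
have cs : computable (fun x => words_upto ((false, false) :: (false, false) :: h x)).
  apply: computable_words_upto; apply: computable_cons; first exact: computable_cst.
  by apply: computable_cons => //; exact: computable_cst.
apply: (computable_has (h := fun p => has (fun x => if behead x == [::] then false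
  else reduce (flatten [seq p.1 | _ <- x]) == reduce (h p.2))
  (words_upto ((false, false) :: (false, false) :: h p.2)))) => //.
have c2 : computable (@snd word X) by exact: computable_snd.
apply: (computable_has (h := fun q => if behead q.1 == [::] then false
  else reduce (flatten [seq q.2.1 | _ <- q.1]) == reduce (h q.2.2))).
  exact: (computable_comp cs c2).
have d1 : computable (@fst word (word * X)%type) by exact: computable_fst.
have d2 : computable (@snd word (word * X)%type) by exact: computable_snd.
apply: computable_if; first apply: computable_eq enc_word_inj _ _.
- exact: computable_behead.
- exact: computable_cst.
- exact: computable_cst.
apply: computable_eq enc_word_inj _ _.
  apply: computable_reduce; apply: computable_flatten.
  apply: (computable_map (h := fun r => r.2.2.1)) => //.
  apply: computable_fstf; apply: computable_sndf; exact: computable_snd.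
apply: computable_reduce; apply: (computable_comp ch); exact: computable_sndf.
Qed.

End ComputableTests.

Lemma computable_algorithm : computable algorithm.
Proof.
have ci : computable (@id (seq word)) by exact: computable_id.
pose f (U : seq word) := head [::] U; pose g (U : seq word) := head [::] (behead U).
have cf : computable f by exact: computable_head.
have cg : computable g by apply: computable_head; exact: computable_behead.
apply: (computable_filter (h := fun p => if power_test p.1 then false
  else fixed_test (f p.2) (g p.2) p.1)).
  apply: computable_words_upto; apply: computable_cons; first exact: computable_cst.
  exact: computable_cat.
have c1 : computable (@fst word (seq word)) by exact: computable_fst.
have c2 : computable (@snd word (seq word)) by exact: computable_snd.
apply: computable_if; first exact: computable_power_test.
  exact: computable_cst.
by apply: computable_fixed_test => //; apply: computable_comp c2.
Qed.

Lemma algorithm_murec :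
  exists A : murec 1, forall U : seq word,
    eval A [tuple words_code U] (words_code (algorithm U)).
Proof.
have [F [A AF] FE] := computable_algorithm; exists A => U.
have := AF [tuple words_code U]; rewrite /=.
have E (V : seq word) : words_code V = enc V by [].
by rewrite E FE.
Qed.

(** * The free group of rank two and its bases *)

Local Open Scope group_scope.

Lemma inv_wordK : involutive inv_word.
Proof.
by move=> w; rewrite /inv_word map_rev revK -map_comp map_id_in // => x _ /=;
  rewrite letter_invK.
Qed.

Lemma inv_word_cat u v : inv_word (u ++ v) = inv_word v ++ inv_word u.
Proof. by rewrite /inv_word map_cat rev_cat. Qed.

Lemma size_inv_word w : size (inv_word w) = size w.
Proof. by rewrite size_rev size_map. Qed.

Lemma inv_word_eq0 w : (inv_word w == [::]) = (w == [::]).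
Proof. by rewrite -!size_eq0 size_inv_word. Qed.

(* The last letter of u is the inverse of the first letter of v. *)
Definition cancels (u v : word) : bool :=
  if (ohead (inv_word u), ohead v) is (Some x, Some y) then x == y else false.

Lemma ohead_cat (T : Type) (u v : seq T) :
  ohead (u ++ v) = if ohead u is Some x then Some x else ohead v.
Proof. by case: u. Qed.

Lemma cancels_inv u v : cancels (inv_word v) (inv_word u) = cancels u v.
Proof.
by rewrite /cancels inv_wordK; case: (ohead v) => [x|]; case: (ohead _) => [y|] //; rewrite eq_sym.
Qed.

Lemma reduced_cons x w : reduced (x :: w) = reduced w && ~~ cancels [:: x] w.
Proof. by case: w => [|y w] //=; rewrite /cancels /= [in RHS]eq_sym andbC. Qed.

Lemma reduced_cat u v : reduced (u ++ v) = [&& reduced u, reduced v & ~~ cancels u v].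
Proof.
elim: u => [|x u IHu]; first by rewrite andbT.
rewrite cat_cons !reduced_cons {}IHu.
have -> : cancels (x :: u) v = if u is [::] then cancels [:: x] v else cancels u v.
  case: u => // y u; rewrite /cancels -cat1s inv_word_cat ohead_cat.
  by rewrite /inv_word /= rev_cons -cats1; case: (rev _).
have -> : cancels [:: x] (u ++ v) = if u is [::] then cancels [:: x] v else cancels [:: x] u.
  by case: u.
by case: u => [|y u]; rewrite ?andbT //= -!andbA; do !bool_congr.
Qed.

Lemma reduced_inv w : reduced (inv_word w) = reduced w.
Proof.
elim: w => [|x w IHw] //; rewrite -cat1s inv_word_cat !reduced_cat {}IHw.
by rewrite cancels_inv andbCA.
Qed.

Lemma reduced_catl u v : reduced (u ++ v) -> reduced u.
Proof. by rewrite reduced_cat => /and3P[]. Qed.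

Lemma reduced_catr u v : reduced (u ++ v) -> reduced v.
Proof. by rewrite reduced_cat => /and3P[]. Qed.

Lemma cancels_catl u v w : v != [::] -> cancels (u ++ v) w = cancels v w.
Proof.
rewrite -inv_word_eq0 /cancels inv_word_cat ohead_cat => v0.
by case: (inv_word v) v0.
Qed.

Lemma cancels_catr u v w : v != [::] -> cancels u (v ++ w) = cancels u v.
Proof. by rewrite /cancels ohead_cat; case: v. Qed.

(** Reducedness concerns adjacent letters only, and across a non-empty overlap every adjacent pair
    lies in one of the two given words. *)
Lemma reduced_overlap u v w : v != [::] ->
  reduced (u ++ v) -> reduced (v ++ w) -> reduced (u ++ v ++ w).
Proof.
rewrite !reduced_cat => v0 /and3P[-> -> mu] /and3P[_ -> ->] /=.
by rewrite cancels_catr.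
Qed.

Lemma eltK (g : F2) : elt g = g.
Proof. by apply: wval_inj; exact: foldr_push_reduced (wvalP g). Qed.

Lemma wval_elt w : reduced w -> wval (elt w) = w.
Proof. exact: foldr_push_reduced. Qed.

Lemma elt0 : elt [::] = 1. Proof. by []. Qed.

Lemma elt_cat u v : elt (u ++ v) = elt u * elt v.
Proof.
apply: wval_inj; rewrite [RHS]F2_mulE /= /reduce foldr_cat.
by rewrite -{1}[foldr push [::] v]/(foldr push (reduce v) [::]) foldr_push_comp
  ?reduced_reduce.
Qed.

Lemma elt_inv w : elt (inv_word w) = (elt w)^-1.
Proof.
apply: (mulIg (elt w)); rewrite mulVg -elt_cat; apply: wval_inj => /=.
exact: foldr_push_inv.
Qed.

Lemma wval_inv (g : F2) : wval g^-1 = inv_word g.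
Proof. by rewrite -{1}[g]eltK -elt_inv wval_elt // reduced_inv wvalP. Qed.

Lemma wval_eq0 (g : F2) : (wval g == [::]) = (g == 1).
Proof. by apply/eqP/eqP => [E|->//]; apply: wval_inj. Qed.

Lemma size_push x w : (size (push x w) <= (size w).+1)%N.
Proof. by case: w => //= y w; case: ifP => //= _; rewrite leqW. Qed.

Lemma size_elt w : (size (elt w) <= size w)%N.
Proof.
by elim: w => //= x w IHw; apply: leq_trans (size_push _ _) _; rewrite ltnS.
Qed.

Lemma size_mul (g h : F2) : (size (g * h)%g <= size g + size h)%N.
Proof. by rewrite -{1}[g]eltK -{1}[h]eltK -elt_cat -size_cat size_elt. Qed.

Lemma size_inv (g : F2) : size g^-1 = size g.
Proof. by rewrite wval_inv size_inv_word. Qed.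

Definition lett (x : letter) : F2 := elt [:: x].

Lemma lett_inv x : lett (letter_inv x) = (lett x)^-1.
Proof. by rewrite -elt_inv. Qed.

Lemma elt_cons x w : elt (x :: w) = lett x * elt w.
Proof. by rewrite -cat1s elt_cat. Qed.

(** * Endomorphisms given by the images of a and b *)

Definition letter_ev (S T : F2) (x : letter) : F2 :=
  let g := if x.1 then T else S in if x.2 then g^-1 else g.

Definition word_ev (S T : F2) (w : word) : F2 :=
  foldr (fun x g => letter_ev S T x * g) 1 w.

(** This is the endomorphism with a -> S and b -> T; by [ev_unique] every endomorphism has this
    form. *)
Definition ev (S T g : F2) : F2 := word_ev S T g.

Section Ev.
Variables S T : F2.

Lemma letter_evV x : letter_ev S T (letter_inv x) = (letter_ev S T x)^-1.
Proof. by case: x => g [] //=; rewrite /letter_ev /= invgK. Qed.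

Lemma word_ev_push x w : word_ev S T (push x w) = letter_ev S T x * word_ev S T w.
Proof.
case: w => //= y w; case: eqP => //= ->.
by rewrite letter_evV mulVKg.
Qed.

Lemma word_ev_reduce w : word_ev S T (reduce w) = word_ev S T w.
Proof. by elim: w => //= x w IHw; rewrite word_ev_push IHw. Qed.

Lemma word_ev_cat u v : word_ev S T (u ++ v) = word_ev S T u * word_ev S T v.
Proof. by elim: u => [|x u IHu] /=; rewrite ?mul1g // IHu mulgA. Qed.

Lemma ev_elt w : ev S T (elt w) = word_ev S T w.
Proof. exact: word_ev_reduce. Qed.

Lemma evM : {morph ev S T : g h / g * h}.
Proof.
by move=> g h; rewrite -{1}[g]eltK -{1}[h]eltK -elt_cat ev_elt word_ev_cat.
Qed.

Lemma ev1 : ev S T 1 = 1. Proof. by []. Qed.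

Lemma evV : {morph ev S T : g / g^-1}.
Proof. by move=> g; apply: (mulIg (ev S T g)); rewrite -evM !mulVg. Qed.

Lemma evJ g h : ev S T (g ^ h) = ev S T g ^ ev S T h.
Proof. by rewrite !conjgE !evM evV. Qed.

Lemma evX g n : ev S T (g ^+ n) = ev S T g ^+ n.
Proof. by elim: n => // n IHn; rewrite !expgS evM IHn. Qed.

Lemma ev_a : ev S T gen_a = S.
Proof. by rewrite /ev /= /letter_ev /= mulg1. Qed.

Lemma ev_b : ev S T gen_b = T.
Proof. by rewrite /ev /= /letter_ev /= mulg1. Qed.

Lemma ev_lett x : ev S T (lett x) = letter_ev S T x.
Proof. by rewrite /ev /= mulg1. Qed.

Lemma ev_unique (f : F2 -> F2) : {morph f : g h / g * h} ->
  f gen_a = S -> f gen_b = T -> f =1 ev S T.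
Proof.
move=> fM fa fb; have f1 : f 1 = 1.
  by apply: (mulgI (f 1)); rewrite -fM !mulg1.
have fV g : f g^-1 = (f g)^-1.
  by apply: (mulIg (f g)); rewrite -fM !mulVg.
move=> g; rewrite -[g]eltK ev_elt; elim: (wval g) => //= x w <-.
rewrite elt_cons fM; congr (_ * _); case: x => [[] []]; rewrite /letter_ev /=;
  rewrite -?fa -?fb // -fV; congr f; exact: wval_inj.
Qed.

End Ev.

Lemma ev_id g : ev gen_a gen_b g = g.
Proof. by rewrite -(@ev_unique _ _ id). Qed.

Lemma ev_ev S T s t g : ev S T (ev s t g) = ev (ev S T s) (ev S T t) g.
Proof.
apply: (@ev_unique _ _ (fun g => ev S T (ev s t g))); rewrite ?ev_a ?ev_b //.
by move=> x y; rewrite !evM.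
Qed.

Lemma ev_conj S T g h : ev (S ^ g) (T ^ g) h = ev S T h ^ g.
Proof.
rewrite -(@ev_unique _ _ (fun h => ev S T h ^ g)) ?ev_a ?ev_b //.
by move=> x y; rewrite evM conjMg.
Qed.

(** Generation by Nielsen moves and conjugations gives an induction principle for bases; that such a
    pair defines an automorphism is [basis_bij]. *)
Inductive basis : F2 -> F2 -> Prop :=
| basis_gen : basis gen_a gen_b
| basis_swap s t : basis s t -> basis t s
| basis_inv s t : basis s t -> basis s^-1 t
| basis_mul s t : basis s t -> basis (s * t) t
| basis_conj s t g : basis s t -> basis (s ^ g) (t ^ g).

Lemma basis_ev s t x y : basis s t -> basis x y -> basis (ev s t x) (ev s t y).
Proof.
move=> st; elim=> {x y} [|x y _ IH|x y _ IH|x y _ IH|x y g _ IH].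
- by rewrite ev_a ev_b.
- exact: basis_swap.
- by rewrite evV; exact: basis_inv.
- by rewrite evM; exact: basis_mul.
- by rewrite !evJ; exact: basis_conj.
Qed.

Lemma basis_invr s t : basis s t -> basis s t^-1.
Proof. by move=> st; apply: basis_swap; apply: basis_inv; exact: basis_swap. Qed.

Lemma basis_mulr s t : basis s t -> basis s (t * s).
Proof. by move=> st; apply: basis_swap; apply: basis_mul; exact: basis_swap. Qed.

Lemma basis_inverse s t : basis s t -> exists x y,
  [/\ basis x y, ev s t x = gen_a, ev s t y = gen_b, ev x y s = gen_a
    & ev x y t = gen_b].
Proof.
(* Inverses compose: (p, q) is one move with inverse (p', q'), and (x, y) inverts the basis (s0, t0)
   reached before it. *)
have step s0 t0 p q p' q' x y : basis p' q' -> ev p q p' = gen_a ->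
    ev p q q' = gen_b -> ev p' q' p = gen_a -> ev p' q' q = gen_b ->
    [/\ basis x y, ev s0 t0 x = gen_a, ev s0 t0 y = gen_b, ev x y s0 = gen_a
    & ev x y t0 = gen_b] -> exists x y,
    [/\ basis x y, ev (ev s0 t0 p) (ev s0 t0 q) x = gen_a,
     ev (ev s0 t0 p) (ev s0 t0 q) y = gen_b, ev x y (ev s0 t0 p) = gen_a
    & ev x y (ev s0 t0 q) = gen_b].
  move=> bpq pp qq p'p q'q [bxy sx ty xs yt]; exists (ev p' q' x), (ev p' q' y).
  split; first exact: basis_ev.
  - by rewrite -ev_ev [ev p q _]ev_ev pp qq ev_id.
  - by rewrite -ev_ev [ev p q _]ev_ev pp qq ev_id.
  - by rewrite -ev_ev [ev x y _]ev_ev xs yt ev_id.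
  - by rewrite -ev_ev [ev x y _]ev_ev xs yt ev_id.
elim=> {s t} [|s t _|s t _|s t _|s t g _].
- by exists gen_a, gen_b; split; rewrite ?ev_id //; exact: basis_gen.
- case=> x [y H]; have := step s t gen_b gen_a gen_b gen_a x y.
  by rewrite !ev_a !ev_b; apply=> //; apply: basis_swap; exact: basis_gen.
- case=> x [y H]; have := step s t gen_a^-1 gen_b gen_a^-1 gen_b x y.
  rewrite !evV !ev_a !ev_b !invgK; apply=> //; apply: basis_inv; exact: basis_gen.
- case=> x [y H]; have := step s t (gen_a * gen_b) gen_b (gen_a * gen_b^-1) gen_b x y.
  rewrite !evM !evV !ev_a !ev_b mulgK mulgVK; apply=> //.
  have := basis_mul (basis_invr basis_gen) => /basis_invr; by rewrite invgK.
(* The conjugator [g] is pulled back to [h], so that this move too is the image under [ev s t] of a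
   move on (a, b). *)
- case=> x [y H]; have [_ sx ty _ _] := H; pose h := ev x y g.
  have gE : ev s t h = g by rewrite /h ev_ev sx ty ev_id.
  have := step s t (gen_a ^ h) (gen_b ^ h) (gen_a ^ h^-1) (gen_b ^ h^-1) x y.
  rewrite !ev_conj !ev_id !conjgK !conjgKV.
  rewrite [ev s t (gen_a ^ h)]evJ [ev s t (gen_b ^ h)]evJ ev_a ev_b gE.
  by apply=> //; exact: basis_conj basis_gen.
Qed.

Lemma basis_bij s t : basis s t ->
  exists x y, [/\ basis x y, cancel (ev s t) (ev x y) & cancel (ev x y) (ev s t)].
Proof.
case/basis_inverse=> x [y [bxy sx ty xs yt]]; exists x, y; split=> // g.
  by rewrite ev_ev xs yt ev_id.
by rewrite ev_ev sx ty ev_id.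
Qed.

(** * Cyclically reduced words *)

Lemma conjugate_refl g : conjugate g g.
Proof. by exists 1; rewrite conjg1. Qed.

Lemma conjugate_sym g h : conjugate g h -> conjugate h g.
Proof. by case=> x ->; exists x^-1; rewrite conjgK. Qed.

Lemma conjugate_trans g h k : conjugate g h -> conjugate h k -> conjugate g k.
Proof. by case=> x -> [y ->]; exists (x * y); rewrite conjgM. Qed.

Lemma conjugateJ g x : conjugate g (g ^ x).
Proof. by exists x. Qed.

Lemma conjugate_ev S T g h : conjugate g h -> conjugate (ev S T g) (ev S T h).
Proof. by case=> x ->; rewrite evJ; exact: conjugateJ. Qed.

Lemma conj_classP g h : conj_class g = conj_class h <-> conjugate g h.
Proof.
split=> [E|gh].
  by have : conj_class h h by [exact: conjugate_refl]; rewrite -E.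
apply/seteqP; split=> k; rewrite /conj_class /= => gk.
  exact: conjugate_trans (conjugate_sym gh) gk.
exact: conjugate_trans gh gk.
Qed.

Definition cred (w : word) : bool := reduced (w ++ w).

Lemma credE w : cred w = reduced w && ~~ cancels w w.
Proof. by rewrite /cred reduced_cat; case: (reduced w). Qed.

Lemma cred_reduced w : cred w -> reduced w.
Proof. by rewrite credE => /andP[]. Qed.

Lemma cred_catC u v : cred (u ++ v) -> cred (v ++ u).
Proof.
case: (altP (u =P [::])) => [->|u0]; first by rewrite cats0.
case: (altP (v =P [::])) => [->|v0]; first by rewrite cats0.
rewrite /cred => H.
have uv : reduced (u ++ v) by exact: reduced_catl H.
have vu : reduced (v ++ u).
  by move: H; rewrite -catA => /reduced_catr; rewrite catA => /reduced_catl.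
have vuv : reduced (v ++ u ++ v) by exact: reduced_overlap.
rewrite -catA; apply: (reduced_overlap u0 vu).
exact: reduced_overlap.
Qed.

Definition rotation (r s : word) : Prop := exists i, s = rot i r.

Lemma rotation_refl r : rotation r r.
Proof. by exists 0; rewrite rot0. Qed.

Lemma rotation_catC u v : rotation (u ++ v) (v ++ u).
Proof. by exists (size u); rewrite rot_size_cat. Qed.

Lemma rotationP r s : rotation r s -> exists u v, r = u ++ v /\ s = v ++ u.
Proof. by case=> i ->; exists (take i r), (drop i r); rewrite cat_take_drop. Qed.

Lemma rotation_trans r s t : rotation r s -> rotation s t -> rotation r t.
Proof.
move=> [i ->] [j ->]; case: (leqP (size r) i) => ri.
  by rewrite (rot_oversize ri); exists j.
case: (leqP (size r) j) => rj.
  by rewrite (@rot_oversize _ j) ?size_rot //; exists i.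
by rewrite rot_add_mod ?(ltnW ri) ?(ltnW rj) //; eexists.
Qed.

Lemma rotation_size r s : rotation r s -> size s = size r.
Proof. by case=> i ->; rewrite size_rot. Qed.

Lemma rotation_cred r s : rotation r s -> cred r -> cred s.
Proof. by move/rotationP=> [u [v [-> ->]]]; exact: cred_catC. Qed.

Lemma elt_catC u v : elt (v ++ u) = elt (u ++ v) ^ elt u.
Proof. by rewrite !elt_cat conjgE !mulgA mulVg mul1g. Qed.

Lemma cancels1P u z : cancels u [:: z] ->
  exists u', u = u' ++ [:: letter_inv z].
Proof.
elim/last_ind: u => // u x _; rewrite -cats1 cancels_catl // /cancels /= => /eqP <-.
by exists u; rewrite letter_invK.
Qed.

Lemma elt_cat_conj y r :
  elt (inv_word y ++ r ++ y) = elt r ^ elt y.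
Proof. by rewrite !elt_cat elt_inv conjgE. Qed.

Lemma conj_cred_form r x : cred r -> exists s y,
  [/\ rotation r s, reduced (inv_word y ++ s ++ y)
    & elt r ^ elt x = elt (inv_word y ++ s ++ y)].
Proof.
move=> cr; have [->|r0] := eqVneq r [::].
  exists [::], [::]; split=> //; first exact: rotation_refl.
  by rewrite elt0 conj1g.
elim/last_ind: x => [|x z [s [y [rs red E]]]].
  exists r, [::]; rewrite cats0 elt0 conjg1; split=> //; first exact: rotation_refl.
  exact: cred_reduced.
rewrite -cats1 elt_cat conjgM {}E -[elt [:: z]]/(lett z).
have s0 : s != [::] by rewrite -size_eq0 (rotation_size rs) size_eq0.
have [y0|y0] := eqVneq y [::].
  rewrite {y}y0 /= cats0 in red *; have cs := rotation_cred rs cr.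
  case: (boolP (cancels s [:: z])) => [/cancels1P[s' Es]|c1].
    exists ([:: letter_inv z] ++ s'), [::]; rewrite cats0; split.
    - apply: rotation_trans rs _; rewrite Es; exact: rotation_catC.
    - by apply: cred_reduced; apply: (@cred_catC s'); rewrite -Es.
    rewrite Es elt_cat -[elt [:: _]]/(lett _) lett_inv conjgE mulgVK -lett_inv.
    by rewrite -[RHS]/(elt (_ :: _)) elt_cons.
  case: (boolP (cancels (inv_word [:: z]) s)) => [|c2].
    rewrite -cancels_inv inv_wordK => /cancels1P[s' Es].
    have {}Es : s = [:: z] ++ inv_word s'.
      by rewrite -[s]inv_wordK Es inv_word_cat /inv_word /= letter_invK.
    exists (inv_word s' ++ [:: z]), [::]; rewrite cats0; split.
    - apply: rotation_trans rs _; rewrite Es; exact: rotation_catC.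
    - by apply: cred_reduced; apply: (@cred_catC [:: z]); rewrite -Es.
    by rewrite [RHS](elt_catC [:: z]) -Es.
  exists s, [:: z]; split=> //; last by rewrite elt_cat_conj.
  have rs' := cred_reduced cs.
  by apply: reduced_overlap => //; rewrite reduced_cat rs' ?c1 ?c2.
case: (boolP (cancels y [:: z])) => [/cancels1P[y' Ey]|c].
  exists s, y'; move: red; rewrite Ey !elt_cat_conj elt_cat conjgM.
  rewrite -[elt [:: _]]/(lett _) lett_inv conjgKV inv_word_cat => red; split=> //.
  by move: red; rewrite !catA => /reduced_catl; rewrite -!catA => /reduced_catr.
exists s, (y ++ [:: z]); split=> //; last first.
  by rewrite !elt_cat_conj elt_cat conjgM.
rewrite inv_word_cat; set m := inv_word y ++ s ++ y.
have -> : (inv_word [:: z] ++ inv_word y) ++ s ++ y ++ [:: z] =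
  inv_word [:: z] ++ m ++ [:: z] by rewrite /m -!catA.
apply: reduced_overlap; first by rewrite /m; case: (inv_word y) s0 => //; case: (s).
  rewrite reduced_cat red /= /m cancels_catr ?inv_word_eq0 //.
  by rewrite cancels_inv.
by rewrite reduced_cat red /= /m catA cancels_catl.
Qed.

(** A non-empty stem in [conj_cred_form] would make the last letter of [s] the inverse of its
    first. *)
Lemma cred_conj_cred r s : cred r -> cred s -> conjugate (elt r) (elt s) ->
  rotation r s.
Proof.
move=> cr cs [x Ex]; rewrite -[x]eltK in Ex.
have [t [y [rt red Et]]] := conj_cred_form x cr.
have Es : s = inv_word y ++ t ++ y.
  by rewrite -(wval_elt red) -Et -Ex wval_elt ?cred_reduced.
suff y0 : y = [::] by rewrite Es y0 cats0.
case: (altP (y =P [::])) => // y0; move: cs; rewrite credE => /andP[_].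
rewrite {}Es cancels_catr ?inv_word_eq0 // catA cancels_catl //.
rewrite /cancels; case E: (inv_word y) => [|z u] /=; last by rewrite eqxx.
by move: y0; rewrite -inv_word_eq0 E.
Qed.

Lemma exists_cred w : reduced w -> exists r y,
  [/\ cred r, w = inv_word y ++ r ++ y & conjugate (elt r) (elt w)].
Proof.
have [n] := ubnP (size w); elim: n w => // n IHn w ltn rw.
case: (boolP (cred w)) => [cw|].
  by exists w, [::]; rewrite cats0; split=> //; exact: conjugate_refl.
rewrite credE rw negbK /=; case: w ltn rw => // x w ltn rw.
rewrite -cat1s cancels_catr // => /cancels1P.
case=> -[|z u] [E]; first by have := letter_inv_neq x; rewrite -E eqxx.
move=> Ew; subst w; rewrite cat1s.
have ru : reduced u by move: rw; rewrite -cat1s => /reduced_catr /reduced_catl.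
have [||r [y [cr Eu cru]]] := IHn u => //.
  by move: ltn; rewrite /= size_cat /=; lia.
have Ew : x :: u ++ [:: letter_inv x] =
  inv_word (y ++ [:: letter_inv x]) ++ r ++ y ++ [:: letter_inv x].
  by rewrite inv_word_cat Eu -!catA /= /inv_word /= letter_invK.
exists r, (y ++ [:: letter_inv x]); split=> //.
by rewrite Ew elt_cat_conj; exact: conjugateJ.
Qed.

Lemma cred_conj_size r g : cred r -> conjugate (elt r) g -> (size r <= size g)%N.
Proof.
move=> cr [x ->]; rewrite -[x]eltK.
have [t [y [rt red ->]]] := conj_cred_form x cr.
by rewrite wval_elt // !size_cat (rotation_size rt); lia.
Qed.

Lemma elt_flatten_nseq p w : elt (flatten (nseq p w)) = elt w ^+ p.
Proof. by elim: p => //= p IHp; rewrite elt_cat IHp expgS. Qed.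

Lemma reduced_power r p : cred r -> reduced (flatten (nseq p r)).
Proof.
move=> cr; case: p => // p; have [->|r0] := eqVneq r [::].
  by elim: p => //=.
elim: p => [|p IHp]; first by rewrite /= cats0 cred_reduced.
by rewrite /= in IHp *; apply: reduced_overlap.
Qed.

(** Taking powers repeats only the cyclically reduced core and keeps the stem. The two inequalities
    bound the search for roots and exponents in [power_test]. *)
Lemma size_expg (g : F2) p : g != 1 -> (0 < p)%N ->
  (size g <= size (g ^+ p) /\ p <= size (g ^+ p))%N.
Proof.
move=> g1 p0; have [r [y [cr Eg cgr]]] := exists_cred (wvalP g).
have r0 : r != [::].
  apply: contra g1 => /eqP r0; apply/eqP; rewrite -[g]eltK Eg r0.
  by rewrite elt_cat_conj elt0 conj1g.
have Ep : wval (g ^+ p) = inv_word y ++ flatten (nseq p r) ++ y.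
  rewrite -{1}[g]eltK Eg elt_cat_conj -conjXg -elt_flatten_nseq -elt_cat_conj.
  rewrite wval_elt //; have := wvalP g; rewrite Eg => red.
  have red1 : reduced (inv_word y ++ r).
    by move: red; rewrite catA => /reduced_catl.
  have red2 : reduced (r ++ y) by exact: reduced_catr red.
  case: p p0 => // p _; have rp := @reduced_power r p.+1 cr.
  apply: reduced_overlap; first by case: (r) r0.
    by apply: (@reduced_overlap _ r).
  move: rp; rewrite -addn1 nseqD flatten_cat /= cats0 -catA => rp.
  exact: reduced_overlap.
rewrite Ep Eg !size_cat size_flatten /shape map_nseq sumn_nseq.
have : (0 < size r)%N by rewrite lt0n size_eq0.
by split; nia.
Qed.

(** * Exponents and monotone bases *)

Definition letter_expo (c : bool) (x : letter) : int :=
  if x.1 == c then (if x.2 then (-1)%R else 1%R) else 0%R.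

Fixpoint word_expo (c : bool) (w : word) : int :=
  if w is x :: w' then (letter_expo c x + word_expo c w')%R else 0%R.

(* Exponent sum of a (c = false) or of b (c = true). *)
Definition expo (c : bool) (g : F2) : int := word_expo c g.

Section Expo.
Variable c : bool.

Lemma letter_expoV x : letter_expo c (letter_inv x) = (- letter_expo c x)%R.
Proof. by case: x => d [] /=; rewrite /letter_expo /=; case: eqP; lia. Qed.

Lemma word_expo_cat u v : word_expo c (u ++ v) = (word_expo c u + word_expo c v)%R.
Proof. by elim: u => /= [|x u ->]; lia. Qed.

Lemma word_expo_reduce w : word_expo c (reduce w) = word_expo c w.
Proof.
elim: w => //= x w <-; case: (reduce w) => //= y v; case: eqP => //= ->.
by rewrite letter_expoV; lia.
Qed.

Lemma expo_elt w : expo c (elt w) = word_expo c w.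
Proof. exact: word_expo_reduce. Qed.

Lemma expoM g h : expo c (g * h) = (expo c g + expo c h)%R.
Proof. by rewrite -{1}[g]eltK -{1}[h]eltK -elt_cat expo_elt word_expo_cat. Qed.

Lemma expo1 : expo c 1 = 0%R. Proof. by []. Qed.

Lemma expoV g : expo c g^-1 = (- expo c g)%R.
Proof. by have := expoM g g^-1; rewrite mulgV expo1; lia. Qed.

Lemma expoJ g h : expo c (g ^ h) = expo c g.
Proof. by rewrite conjgE !expoM expoV; lia. Qed.

Lemma expo_conj g h : conjugate g h -> expo c g = expo c h.
Proof. by case=> x ->; rewrite expoJ. Qed.

End Expo.

Lemma expo_ev c S T g :
  expo c (ev S T g) = (expo c S * expo false g + expo c T * expo true g)%R.
Proof.
rewrite -[g]eltK ev_elt !expo_elt /=; elim: (wval g) => /= [|x w IHw].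
  by rewrite expo1; lia.
rewrite expoM {}IHw; case: x => [[] []]; rewrite /letter_ev /letter_expo /=;
  rewrite ?expoV; lia.
Qed.

Lemma expo_size c w : (`|word_expo c w| <= size w)%N.
Proof.
elim: w => //= x w IHw; have : (`|letter_expo c x| <= 1)%N.
  by rewrite /letter_expo; case: ifP => //; case: (x.2).
lia.
Qed.

(** The moves act on the exponent matrix by unimodular operations, so its determinant changes at
    most in sign. *)
Lemma basis_det s t : basis s t ->
  let d := (expo false s * expo true t - expo true s * expo false t)%R in
  d = 1%R \/ d = (-1)%R.
Proof.
rewrite /=; elim=> {s t} [|s t _ IH|s t _ IH|s t _ IH|s t g _ IH]; first by left.
- by lia.
- by rewrite !expoV; lia.
- by rewrite !expoM; lia.
- by rewrite !expoJ.
Qed.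

(** For two letters [x] and [y] of different generators these are the Christoffel pairs. *)
Inductive positive_basis (x y : F2) : F2 -> F2 -> Prop :=
| positive_basis_refl : positive_basis x y x y
| positive_basis_mull s t :
    positive_basis x y s t -> positive_basis x y (s * t) t
| positive_basis_mulr s t :
    positive_basis x y s t -> positive_basis x y s (s * t).

Definition monotone_pair (s t : F2) : Prop :=
  exists x y g, x.1 != y.1 /\ positive_basis (lett x) (lett y) (s ^ g) (t ^ g).

Lemma positive_basis_conj x y s t g : positive_basis x y s t ->
  positive_basis (x ^ g) (y ^ g) (s ^ g) (t ^ g).
Proof.
elim=> {s t} [|s t _ IH|s t _ IH]; first exact: positive_basis_refl.
  by rewrite conjMg; exact: positive_basis_mull.
by rewrite conjMg; exact: positive_basis_mulr.
Qed.

(** A conjugator has to be allowed: after the swap the moves form t s, which is s t conjugated by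
    t^-1 or by s. *)
Lemma positive_basis_swap x y s t : positive_basis x y s t ->
  exists g, positive_basis y x (t ^ g) (s ^ g).
Proof.
elim=> {s t} [|s t _ [g IH]|s t _ [g IH]].
- by exists 1; rewrite !conjg1; exact: positive_basis_refl.
- exists (t^-1 * g); rewrite !conjgM.
  have -> : t ^ t^-1 = t by rewrite conjgE mulgV mulg1 invgK.
  have -> : (s * t) ^ t^-1 = t * s by rewrite conjgE invgK mulgK.
  by rewrite conjMg; exact: positive_basis_mulr.
- exists (s * g); rewrite !conjgM.
  have -> : s ^ s = s by rewrite conjgE mulKg.
  have -> : (s * t) ^ s = t * s by rewrite conjgE !mulgA mulVg mul1g.
  by rewrite conjMg; exact: positive_basis_mull.
Qed.

Lemma positive_basis_inv x y s t : positive_basis x y s t ->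
  exists g, positive_basis x^-1 y^-1 (s^-1 ^ g) (t^-1 ^ g).
Proof.
elim=> {s t} [|s t _ [g IH]|s t _ [g IH]].
- by exists 1; rewrite !conjg1; exact: positive_basis_refl.
- exists (t^-1 * g); rewrite !conjgM.
  have -> : t^-1 ^ t^-1 = t^-1 by rewrite conjgE mulKg.
  have -> : (s * t)^-1 ^ t^-1 = s^-1 * t^-1 by rewrite conjgE invgM !mulgA mulVg mul1g.
  by rewrite conjMg; exact: positive_basis_mull.
- exists (s * g); rewrite !conjgM.
  have -> : s^-1 ^ s = s^-1 by rewrite conjgE mulVg mulg1.
  have -> : (s * t)^-1 ^ s = s^-1 * t^-1 by rewrite conjgE invgM mulgVK.
  by rewrite conjMg; exact: positive_basis_mulr.
Qed.

Lemma monotone_conj s t h : monotone_pair (s ^ h) (t ^ h) <-> monotone_pair s t.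
Proof.
split=> -[x [y [g [xy P]]]]; exists x, y.
  by exists (h * g); rewrite !conjgM.
by exists (h^-1 * g); rewrite -!conjgM mulVKg.
Qed.

Lemma monotone_swap s t : monotone_pair s t -> monotone_pair t s.
Proof.
case=> x [y [g [xy /positive_basis_swap[h P]]]]; exists y, x, (g * h).
by rewrite !conjgM eq_sym.
Qed.

Lemma monotone_inv s t : monotone_pair s t -> monotone_pair s^-1 t^-1.
Proof.
case=> x [y [g [xy /positive_basis_inv[h P]]]].
exists (letter_inv x), (letter_inv y), (g * h).
by rewrite !lett_inv !conjgM [s^-1 ^ g]conjVg [t^-1 ^ g]conjVg.
Qed.

Lemma monotone_mull s t : monotone_pair s t -> monotone_pair (s * t) t.
Proof.
case=> x [y [g [xy P]]]; exists x, y, g; rewrite conjMg; split=> //.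
exact: positive_basis_mull.
Qed.

Lemma monotone_mulr s t : monotone_pair s t -> monotone_pair s (s * t).
Proof.
case=> x [y [g [xy P]]]; exists x, y, g; rewrite conjMg; split=> //.
exact: positive_basis_mulr.
Qed.

(* A Nielsen move that is negative for a monotone pair undoes its last
   positive move. *)
Lemma basis_monotone s t : basis s t -> monotone_pair s t \/ monotone_pair s t^-1.
Proof.
elim=> {s t} [|s t _ IH|s t _ IH|s t _ IH|s t g _ IH].
- left; exists (false, false), (true, false), 1; rewrite !conjg1; split=> //.
  exact: positive_basis_refl.
- case: IH => /monotone_swap; [by left | move=> /monotone_inv].
  by rewrite invgK; right.
- case: IH => /monotone_inv; [by right | rewrite invgK; by left].
- case: IH => [|[x [y [g [xy P]]]]]; first by move/monotone_mull; left.
  set u := t^-1 in P; have -> : t = u^-1 by rewrite invgK.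
  suff: monotone_pair (s ^ g * (u ^ g)^-1) (u ^ g)^-1
     \/ monotone_pair (s ^ g * (u ^ g)^-1) (u ^ g).
    rewrite -conjVg -conjMg !monotone_conj invgK => -[]; [by left | by right].
  case: P => {s t u g} [|s t P|s t P].
  - left; exists x, (letter_inv y), 1; rewrite !conjg1 lett_inv; split=> //.
    by apply: positive_basis_mull; exact: positive_basis_refl.
  - by right; rewrite mulgK; exists x, y, 1; rewrite !conjg1.
  (* The last positive move gave (s, s t). Up to conjugation the new pair is (t^-1, t^-1 s^-1), one
     positive move after (t^-1, s^-1). *)
  have : monotone_pair s t by exists x, y, 1; rewrite !conjg1.
  move/monotone_inv/monotone_swap/monotone_mulr=> /(monotone_conj _ _ t^-1) M.
  left; apply/(monotone_conj _ _ s); rewrite invgM.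
  have -> : (s * (t^-1 * s^-1)) ^ s = t^-1 ^ t^-1.
    by rewrite !conjgE mulKg !mulgA mulVg mul1g mulgVK.
  have -> // : (t^-1 * s^-1) ^ s = (t^-1 * s^-1) ^ t^-1.
  by rewrite !conjgE mulgVK mulgA mulKg.
- by rewrite -conjVg !monotone_conj.
Qed.

Definition positive (x y : letter) (w : word) : bool :=
  all [pred z | (z == x) || (z == y)] w.

Section Positive.
Variables x y : letter.
Hypothesis xy : x.1 != y.1.

Lemma positive_reduced w : positive x y w -> reduced w.
Proof.
elim: w => [|z w IHw] // /andP[zxy pw]; rewrite reduced_cons IHw //; rewrite /= in zxy.
case: w pw {IHw} => //= z' w /andP[/= zxy' _]; rewrite /cancels /=.
apply/negP => /eqP E; case/orP: zxy E => /eqP ->; case/orP: zxy' => /eqP -> E.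
- by have := letter_inv_neq x; rewrite E eqxx.
- by move: xy; rewrite -E eqxx.
- by move: xy; rewrite -E eqxx.
- by have := letter_inv_neq y; rewrite E eqxx.
Qed.

Lemma positive_cat u v : positive x y (u ++ v) = positive x y u && positive x y v.
Proof. exact: all_cat. Qed.

Lemma positive_cred w : positive x y w -> cred w.
Proof. by move=> pw; apply: positive_reduced; rewrite positive_cat pw. Qed.

Lemma positive_rotation r s : rotation r s -> positive x y r -> positive x y s.
Proof.
move=> /rotationP[u [v [-> ->]]]; by rewrite !positive_cat andbC.
Qed.

Lemma positive_mul (g h : F2) : positive x y g -> positive x y h ->
  wval (g * h) = wval g ++ wval h.
Proof.
move=> pg ph; rewrite -{1}[g]eltK -{1}[h]eltK -elt_cat wval_elt //.
by apply: positive_reduced; rewrite positive_cat pg.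
Qed.

(** The last clause is the Christoffel property: s t and t s differ by one swap of adjacent letters,
    and a move only adds a common prefix or suffix to both products. *)
Lemma positive_basis_words s t : positive_basis (lett x) (lett y) s t ->
  [/\ positive x y s, positive x y t, wval s != [::], wval t != [::] &
    exists u v, wval s ++ wval t = u ++ [:: x; y] ++ v /\
                wval t ++ wval s = u ++ [:: y; x] ++ v].
Proof.
elim=> {s t} [|s t _ [ps pt s0 t0 [u [v [st ts]]]]|s t _ [ps pt s0 t0 [u [v [st ts]]]]].
- by rewrite /positive /= !eqxx orbT; split=> //; exists [::], [::].
- rewrite (positive_mul ps pt) positive_cat ps pt; split=> //; first by case: (wval s) s0.
  by exists u, (v ++ t); split; [rewrite st -!catA | rewrite catA ts -!catA].
- rewrite (positive_mul ps pt) positive_cat ps pt; split=> //; first by case: (wval s) s0.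
  by exists (s ++ u), v; split; [rewrite st -!catA | rewrite -catA ts -!catA].
Qed.

End Positive.

(** Both sides are the first |s| + i letters of s t s. *)
Lemma take_rot_cat (s t : word) i : (i <= size (s ++ t))%N ->
  take i (s ++ t) ++ take (size s) (rot i (s ++ t)) = s ++ take i (t ++ s).
Proof.
move=> ile; set c := s ++ t; set a := take i c.
have sa : size a = i by rewrite size_takel.
have -> : a ++ take (size s) (rot i c) = take (size s + i) (a ++ rot i c).
  by rewrite addnC takeD take_size_cat // drop_size_cat.
rewrite /rot -/a catA cat_take_drop /c -catA takeD take_size_cat // drop_size_cat //.
congr (_ ++ _); rewrite !take_cat; case: ltnP => // ti; congr (_ ++ _).
rewrite take_takel ?leq_subr // takel_cat //.
by move: ile; rewrite size_cat; lia.
Qed.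

(* The cyclic words s ++ t and t ++ s differ by a swap of two adjacent letters.
   Cutting s ++ t at another place thus gives a pair conjugate to (s, t), except
   when the cut falls between these letters, which changes the exponents. *)
Lemma positive_split_unique x y (s t P Q u v : word) :
  x.1 != y.1 -> s ++ t = u ++ [:: x; y] ++ v -> t ++ s = u ++ [:: y; x] ++ v ->
  rotation (s ++ t) (P ++ Q) -> size P = size s ->
  (forall c, word_expo c P = word_expo c s) ->
  exists g, elt P = elt s ^ g /\ elt Q = elt t ^ g.
Proof.
move=> xy st ts [i0 Ei0] sP eP.
have [i ile Ei] : exists2 i, (i <= size (s ++ t))%N & P ++ Q = rot i (s ++ t).
  case: (leqP i0 (size (s ++ t))) => ?; first by exists i0.
  by exists 0 => //; rewrite Ei0 rot0 rot_oversize // ltnW.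
have := take_rot_cat ile; rewrite -Ei -sP [take _ (P ++ Q)]take_size_cat // => H.
have key g : elt P = elt s ^ g -> elt (P ++ Q) = elt (s ++ t) ^ g ->
    exists g, elt P = elt s ^ g /\ elt Q = elt t ^ g.
  move=> Pg; rewrite !elt_cat conjMg Pg => /mulgI Qg; by exists g.
have PQ : elt (P ++ Q) = elt (s ++ t) ^ elt (take i (s ++ t)).
  by rewrite Ei /rot (elt_catC (take i (s ++ t))) cat_take_drop.
have su : (size u + 2 + size v = size (s ++ t))%N by rewrite st !size_cat /=; lia.
(* If the cut precedes the swapped letters, s t and t s share the prefix a of length [i], and [H]
   reads a P = s a. *)
case: (leqP i (size u)) => iu.
  have E : take i (s ++ t) = take i (t ++ s).
    by rewrite st ts !takel_cat.
  apply: key PQ; apply: (mulgI (elt (take i (s ++ t)))).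
  by rewrite -conjgC -[LHS]elt_cat -[RHS]elt_cat H E.
(* If the cut follows the swapped letters, the suffixes after it agree, and the inverse of this
   suffix is the conjugator. *)
case: (ltnP (size u).+1 i) => iu2.
  have Etake z z' : take i (u ++ [:: z; z'] ++ v) =
      u ++ [:: z; z'] ++ take (i - (size u).+2) v.
    rewrite take_cat ltnNge (ltnW iu) /=; congr (_ ++ _).
    by have -> : (i - size u = (i - (size u).+2).+2)%N by lia.
  have Edrop z z' : drop i (u ++ [:: z; z'] ++ v) = drop (i - (size u).+2) v.
    rewrite drop_cat ltnNge (ltnW iu) /=.
    by have -> : (i - size u = (i - (size u).+2).+2)%N by lia.
  have Edd : drop i (s ++ t) = drop i (t ++ s) by rewrite st ts !Edrop.
  apply: (key (elt (drop i (s ++ t)))^-1).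
    apply: (mulgI (elt (take i (s ++ t)))); rewrite -[LHS]elt_cat H elt_cat.
    have Et : elt t * elt s = elt (take i (t ++ s)) * elt (drop i (t ++ s)).
      by rewrite -[LHS]elt_cat -[RHS]elt_cat cat_take_drop.
    have Es : elt s * elt t = elt (take i (s ++ t)) * elt (drop i (s ++ t)).
      by rewrite -[LHS]elt_cat -[RHS]elt_cat cat_take_drop.
    rewrite conjgE invgK !mulgA -Es Edd -mulgA; apply: (mulIg (elt (drop i (t ++ s)))).
    by rewrite -mulgA -Et !mulgA mulgVK.
  apply: (canRL (conjgK _)); rewrite PQ -conjgM.
  have -> : elt (take i (s ++ t)) * elt (drop i (s ++ t)) = elt (s ++ t).
    by rewrite -[LHS]elt_cat cat_take_drop.
  by rewrite conjgE mulKg.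
(* A cut between the swapped letters makes the two sides of [H] differ in the exponent of the
   generator of [x]. *)
have {}iu : i = (size u).+1 by lia.
move: H; rewrite iu st ts !take_cat ltnNge leqnSn /= subSnn /= ?take0 => H.
have := congr1 (word_expo x.1) H; rewrite !word_expo_cat /= eP.
rewrite /letter_expo eqxx; move: xy; rewrite eq_sym => /negPf ->.
by case: ifP => _; lia.
Qed.

(** * Cyclic words on theta and barbell graphs *)

(* A word in S and T as a path in a graph: x runs along the edge path E x, and
   glue x y is the path from the end of E x to the start of E y. *)
Section Trace.
Variables (S T : F2) (E : letter -> word) (glue : letter -> letter -> word).
Variables pre post : letter -> F2.
Hypothesis E0 : forall x, E x != [::].
Hypothesis Ered : forall x y, y != letter_inv x -> reduced (E x ++ glue x y ++ E y).
Hypothesis Eev : forall x, letter_ev S T x = pre x * elt (E x) * post x.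
Hypothesis glueE :
  forall x y, y != letter_inv x -> post x * pre y = elt (glue x y).

(** [z] is the letter that follows the word; for a cyclic word it is the first letter, and the path
    closes up. *)
Fixpoint trace (w : word) (z : letter) : word :=
  if w is x :: w' then E x ++ glue x (head z w') ++ trace w' z else [::].

Lemma trace_cat u v z : trace (u ++ v) z = trace u (head z v) ++ trace v z.
Proof. by elim: u => //= x u ->; rewrite -!catA; case: u. Qed.

(** The image of a letter is its edge with half-paths [pre] and [post] attached. Inside the word
    [post x] and [pre y] combine to [glue x y]; only the two outer half-paths remain. *)
Lemma word_ev_trace w z : reduced (w ++ [:: z]) ->
  word_ev S T w = pre (head z w) * elt (trace w z) * (pre z)^-1.
Proof.
elim: w => [|x w IHw]; first by rewrite /= elt0 mulg1 mulgV.
rewrite cat_cons reduced_cons => /andP[red nx]; rewrite /= (IHw red) Eev.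
rewrite !elt_cat -glueE; first by rewrite !mulgA.
by case: w nx {IHw red} => [|y w]; rewrite /cancels /= eq_sym.
Qed.

Lemma reduced_E z : reduced (E z).
Proof. exact: reduced_catl (Ered (letter_inv_neq z)). Qed.

Lemma reduced_trace w z : reduced (w ++ [:: z]) -> reduced (trace w z ++ E z).
Proof.
elim: w => [|x w IHw]; first by move=> _; exact: reduced_E.
rewrite cat_cons reduced_cons => /andP[red nx] /=.
have xw : head z w != letter_inv x.
  by case: w nx {IHw red} => [|y w]; rewrite /cancels /= eq_sym.
have [v Ev] : exists v, trace w z ++ E z = E (head z w) ++ v.
  by case: (w) => [|y u]; [exists [::]; rewrite cats0 | rewrite /= -catA; eexists].
have := IHw red; rewrite -!catA Ev => red'.
by rewrite catA; apply: reduced_overlap => //; rewrite -catA; exact: Ered.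
Qed.

(** The trace of the doubled word is the doubled trace, so its reducedness is cyclic reducedness;
    the outer half-paths amount to conjugation by [pre z]. *)
Lemma cred_trace z w : cred (z :: w) ->
  cred (trace (z :: w) z) /\
  conjugate (ev S T (elt (z :: w))) (elt (trace (z :: w) z)).
Proof.
move=> cw; have red : reduced ((z :: w) ++ [:: z]).
  by move: cw; rewrite /cred -[z :: w in X in _ ++ X]cat1s catA => /reduced_catl.
split.
  have := @reduced_trace ((z :: w) ++ (z :: w)) z.
  rewrite trace_cat [head _ _]/= => H; apply: reduced_catl (H _).
  by rewrite -catA; apply: reduced_overlap.
rewrite ev_elt (word_ev_trace red) /=; exists (pre z).
by rewrite conjgE !mulgA mulVg mul1g mulgVK.
Qed.

Lemma size_trace w z : (size w <= size (trace w z))%N.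
Proof.
elim: w => //= x w IHw; rewrite !size_cat.
have : (0 < size (E x))%N by rewrite lt0n size_eq0.
by lia.
Qed.

Lemma trace_glue u x y v z :
  exists p q, trace (u ++ [:: x, y & v]) z = p ++ glue x y ++ q.
Proof.
rewrite trace_cat /=; exists (trace u x ++ E x); eexists; rewrite -!catA.
reflexivity.
Qed.

(** Each letter contributes at least one letter through its edge; a strict gain comes from a longer
    edge, as here, or from a non-empty glue. *)
Lemma size_trace_lt w z x : x \in w -> (1 < size (E x))%N ->
  (size w < size (trace w z))%N.
Proof.
move=> xw Ex; case/splitPr: xw => u v.
rewrite trace_cat /= !size_cat /= ?size_cat.
have := size_trace u x; have := size_trace v z; by lia.
Qed.

Lemma size_trace_glue u x y v z : glue x y != [::] ->
  (size (u ++ [:: x, y & v]) < size (trace (u ++ [:: x, y & v]) z))%N.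
Proof.
move=> g0; rewrite trace_cat /= !size_cat /= ?size_cat.
have : (0 < size (glue x y))%N by rewrite lt0n size_eq0.
have := size_trace u x; have := size_trace v z.
have : (0 < size (E x))%N by rewrite lt0n size_eq0.
have : (0 < size (E y))%N by rewrite lt0n size_eq0.
by lia.
Qed.

End Trace.

Definition signed (w : word) (b : bool) : word := if b then inv_word w else w.

(* Theta graph with edges e1, e2 from P to Q and e3 from Q to P. *)
Definition theta (e1 e2 e3 : word) : bool :=
  [&& e1 != [::], e2 != [::], reduced (e1 ++ e3 ++ e1), reduced (e1 ++ e3 ++ e2),
   reduced (e2 ++ e3 ++ e1), reduced (e2 ++ e3 ++ e2), reduced (e1 ++ inv_word e2)
   & reduced (inv_word e1 ++ e2)].

(* Barbell graph with loops r, r' joined by the path y y'^-1. *)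
Definition barbell (y r y' r' : word) : bool :=
  [&& y != [::], r != [::], r' != [::], cred r, cred r',
   reduced (inv_word y ++ r ++ y), reduced (inv_word y' ++ r' ++ y'),
   reduced (y ++ inv_word y' ++ r') & reduced (y ++ inv_word y' ++ inv_word r')].

Definition theta_edge e1 e2 (x : letter) : word := signed (if x.1 then e2 else e1) x.2.
(** [e3] is crossed between letters of equal sign; at a change of sign the path turns at a vertex
    from one edge directly into the other. *)
Definition theta_glue e3 (x y : letter) : word :=
  if x.2 == y.2 then signed e3 x.2 else [::].

Lemma theta_trace e1 e2 e3 z w : theta e1 e2 e3 -> cred (z :: w) ->
  let W := trace (theta_edge e1 e2) (theta_glue e3) (z :: w) z in
  cred W /\ conjugate (ev (elt (e1 ++ e3)) (elt (e2 ++ e3)) (elt (z :: w))) (elt W).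
Proof.
case/and5P=> e10 e20 r11 r12 /and4P[r21 r22 rd rd'] cw.
have inv3 (u v t : word) : reduced (u ++ v ++ t) ->
    reduced (inv_word t ++ inv_word v ++ inv_word u).
  by rewrite -reduced_inv !inv_word_cat -catA.
have inv2 (u v : word) : reduced (u ++ inv_word v) -> reduced (v ++ inv_word u).
  by rewrite -reduced_inv inv_word_cat inv_wordK.
have inv2' (u v : word) : reduced (inv_word u ++ v) -> reduced (inv_word v ++ u).
  by rewrite -reduced_inv inv_word_cat inv_wordK.
apply: (@cred_trace _ _ _ _ (fun x => if x.2 then (elt e3)^-1 else 1)
  (fun x => if x.2 then 1 else elt e3)) => //.
- by case=> [[] []]; rewrite /theta_edge /= ?inv_word_eq0.
- by case=> [[] []] [[] []] //; rewrite /theta_edge /theta_glue /= => _;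
    first [exact: inv3 | exact: inv2 | exact: inv2'].
- case=> [[] []]; rewrite /theta_edge /letter_ev /= ?elt_inv ?mulg1 ?mul1g elt_cat //;
  by rewrite invgM.
- by case=> [[] []] [[] []] //; rewrite /theta_glue /= => _;
   rewrite ?elt_inv ?mulg1 ?mul1g ?mulgV ?elt0.
Qed.

Definition barbell_edge r r' (x : letter) : word := signed (if x.1 then r' else r) x.2.
Definition barbell_glue y y' (x z : letter) : word :=
  if x.1 == z.1 then [::] else if x.1 then y' ++ inv_word y else y ++ inv_word y'.

Lemma barbell_trace y r y' r' z w : barbell y r y' r' -> cred (z :: w) ->
  let W := trace (barbell_edge r r') (barbell_glue y y') (z :: w) z in
  cred W /\ conjugate (ev (elt (inv_word y ++ r ++ y)) (elt (inv_word y' ++ r' ++ y'))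
    (elt (z :: w))) (elt W).
Proof.
case/and5P=> y0 r0 r'0 cr /and5P[cr' ry ry' yy' yy'V] cw.
have inv u : reduced (inv_word u) -> reduced u by rewrite reduced_inv.
have ryr : reduced (r ++ y) by exact: reduced_catr ry.
have ryr' : reduced (inv_word r ++ y).
  apply: inv; rewrite inv_word_cat inv_wordK.
  by move: ry; rewrite catA => /reduced_catl.
have key b b' : reduced (signed r b ++ (y ++ inv_word y') ++ signed r' b').
  rewrite -catA; apply: reduced_overlap => //; first by case: b.
  by case: b'.
apply: (@cred_trace _ _ _ _ (fun x => elt (inv_word (if x.1 then y' else y)))
  (fun x => elt (if x.1 then y' else y))) => //.
- by case=> [[] []]; rewrite /barbell_edge /= ?inv_word_eq0.
- have credV u : cred u -> reduced (inv_word u ++ inv_word u).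
    by rewrite /cred -reduced_inv inv_word_cat.
  have keyV b b' : reduced (signed r' b' ++ (y' ++ inv_word y) ++ signed r b).
    apply: inv; have := key (~~ b) (~~ b'); rewrite !inv_word_cat inv_wordK.
    by rewrite -!catA; case: b; case: b'; rewrite /= ?inv_wordK.
  by case=> [[] []] [[] []] //; rewrite /barbell_edge /barbell_glue /= => _;
    first [exact: credV | exact: cr | exact: cr' | exact: (key true true)
     | exact: (key true false) | exact: (key false true) | exact: (key false false)
     | exact: (keyV true true)
     | exact: (keyV true false) | exact: (keyV false true) | exact: (keyV false false)].
- by case=> [[] []]; rewrite /barbell_edge /letter_ev /= ?elt_cat ?elt_inv
    ?invgM ?invgK ?mulgA.
- by case=> [[] []] [[] []] //; rewrite /barbell_glue /= => _;
   rewrite ?elt_cat ?elt_inv ?mulgV.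
Qed.

(** * Normal forms of injective pairs under change of basis *)

Definition normal_form (S T : F2) : Prop :=
  (exists e1 e2 e3, [/\ theta e1 e2 e3, S = elt (e1 ++ e3) & T = elt (e2 ++ e3)]) \/
  (exists y r y' r', [/\ barbell y r y' r', S = elt (inv_word y ++ r ++ y)
     & T = elt (inv_word y' ++ r' ++ y')]).

(** The size condition serves [fixed_bound_id], where the loops of the normal form bound the fixed
    word. *)
Definition normalizable (S T : F2) : Prop :=
  exists s t g, [/\ basis s t, normal_form (ev S T s ^ g) (ev S T t ^ g) &
    (size (ev S T s ^ g)%g + size (ev S T t ^ g)%g <= size S + size T)%N].

Lemma normalizable_step S T s t g : basis s t ->
  (size (ev S T s ^ g)%g + size (ev S T t ^ g)%g <= size S + size T)%N ->
  normalizable (ev S T s ^ g) (ev S T t ^ g) -> normalizable S T.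
Proof.
move=> bst le [s' [t' [h [bst' nf le']]]].
have E x : ev S T (ev s t x) ^ (g * h) = ev (ev S T s ^ g) (ev S T t ^ g) x ^ h.
  by rewrite ev_conj -ev_ev conjgM.
exists (ev s t s'), (ev s t t'), (g * h); rewrite !E.
split; [exact: basis_ev | by [] | exact: leq_trans le' le].
Qed.

Lemma injective_step S T s t g : basis s t -> injective (ev S T) ->
  injective (ev (ev S T s ^ g) (ev S T t ^ g)).
Proof.
move=> /basis_bij[x [y [_ c1 _]]] injST h k; rewrite !ev_conj -!ev_ev.
by move/conjg_inj/injST/(can_inj c1).
Qed.

Lemma cancels_headP u v : cancels (inv_word u) v ->
  exists z u' v', u = z :: u' /\ v = z :: v'.
Proof.
rewrite /cancels inv_wordK; case: u v => [|x u] [|y v] //= /eqP ->.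
by exists y, u, v.
Qed.

Lemma elt_rot1 z w : elt (z :: w) ^ lett z = elt (w ++ [:: z]).
Proof. by rewrite elt_cons conjgE -!mulgA mulKg elt_cat. Qed.

Lemma size_conj_head (g : F2) z w : wval g = z :: w -> (size (g ^ lett z)%g <= size g)%N.
Proof.
move=> Eg; rewrite -{1}[g]eltK {1}Eg elt_rot1; apply: leq_trans (size_elt _) _.
by rewrite Eg size_cat /= addn1.
Qed.

Lemma size_conj_noncred (g : F2) z w : wval g = z :: w -> ~~ cred g ->
  (size (g ^ lett z)%g < size g)%N.
Proof.
move=> Eg; rewrite credE wvalP andTb negbK Eg -cat1s cancels_catr // => /cancels1P[u Eu].
case: u Eu => [[E _]|y u [_ Ew]].
  by have := letter_inv_neq z; rewrite -E eqxx.
have -> : g ^ lett z = elt u.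
  rewrite -[g]eltK Eg elt_rot1 Ew -catA elt_cat -[RHS]mulg1; congr (_ * _).
  by rewrite cat1s elt_cons -[elt _]/(lett _) lett_inv mulVg.
by apply: leq_ltn_trans (size_elt _) _; rewrite Ew /= size_cat /=; lia.
Qed.

Lemma normalizable_swap S T : normalizable T S -> normalizable S T.
Proof.
move=> nTS; apply: (@normalizable_step _ _ gen_b gen_a 1).
- exact: basis_swap basis_gen.
- by rewrite !conjg1 ev_a ev_b addnC.
by rewrite !conjg1 ev_a ev_b.
Qed.

Lemma normalizable_inv S T : normalizable S T^-1 -> normalizable S T.
Proof.
move=> n; apply: (@normalizable_step _ _ gen_a gen_b^-1 1).
- exact: basis_invr basis_gen.
- by rewrite !conjg1 ev_a evV ev_b size_inv.
by rewrite !conjg1 ev_a evV ev_b.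
Qed.

Lemma injective_ev_neq1 S T : injective (ev S T) -> S != 1 /\ T != 1.
Proof.
move=> inj; split; apply/eqP => E.
  by have := inj gen_a 1; rewrite ev_a ev1 => /(_ E) /(congr1 wval).
by have := inj gen_b 1; rewrite ev_b ev1 => /(_ E) /(congr1 wval).
Qed.

(** The last clause says that [e3] is the longest common suffix. *)
Lemma common_suffix (u v : word) : exists e1 e2 e3,
  [/\ u = e1 ++ e3, v = e2 ++ e3 & [|| e1 == [::], e2 == [::] | ~~ cancels e1 (inv_word e2)]].
Proof.
elim/last_ind: u v => [|u x IHu] v; first by exists [::], v, [::]; rewrite !cats0.
case/lastP: v => [|v y]; first by exists (rcons u x), [::], [::]; split; rewrite ?cats0 //= orbT.
have [xy|xy] := eqVneq x y.
  have [e1 [e2 [e3 [-> -> H]]]] := IHu v.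
  by exists e1, e2, (rcons e3 x); rewrite -!rcons_cat xy.
exists (rcons u x), (rcons v y), [::]; rewrite !cats0; split=> //.
rewrite -!cats1 inv_word_cat cancels_catl // cancels_catr // /cancels /=.
by rewrite (inj_eq (can_inj letter_invK)) xy !orbT.
Qed.

Section Induction.
Variable n : nat.
Hypothesis IH : forall S T, injective (ev S T) -> (size S + size T < n)%N ->
  normalizable S T.

(** Whenever some change of basis shortens the pair, the induction hypothesis finishes, so only
    pairs that resist shortening need a graph. *)
Lemma normalizable_move S T s t g : basis s t -> injective (ev S T) ->
  (size S + size T <= n)%N ->
  (size (ev S T s ^ g)%g + size (ev S T t ^ g)%g < size S + size T)%N ->
  normalizable S T.
Proof.
move=> bst inj le lt; apply: (normalizable_step bst (ltnW lt)).
by apply: IH; [exact: injective_step | exact: leq_trans lt le].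
Qed.

(** If [T] or its inverse starts with the first letter z of [S], conjugation by z shortens [S] and
    does not lengthen [T]. Otherwise the stem of [S] meets [T] and its inverse without cancellation,
    and the pair is a barbell. *)
Lemma normalizable_noncred S T : injective (ev S T) -> (size S + size T <= n)%N ->
  ~~ cred S -> normalizable S T.
Proof.
move=> inj le ncS; have [S1 T1] := injective_ev_neq1 inj.
case ES: (wval S) => [|z w]; first by move: S1; rewrite -wval_eq0 ES.
case: (boolP (cancels (inv_word S) T || cancels (inv_word S) T^-1)) => [c|].
  apply: (@normalizable_move S T gen_a gen_b (lett z)) => //; first exact: basis_gen.
  rewrite ev_a ev_b -addSn leq_add ?(size_conj_noncred ES) //.
  case/orP: c => /cancels_headP[z' [u' [v' [Eu Ev]]]];
    move: Eu; rewrite ES => -[Ez _]; rewrite -Ez in Ev.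
    exact: size_conj_head Ev.
  by rewrite -size_inv -conjVg -[size T]size_inv; exact: size_conj_head Ev.
rewrite negb_or => /andP[c c'].
have [r [y [cr ESr _]]] := exists_cred (wvalP S).
have [r' [y' [cr' ETr _]]] := exists_cred (wvalP T).
have y0 : y != [::].
  by apply: contra ncS => /eqP y0; rewrite ESr y0 cats0.
have r0 : r != [::].
  apply: contra S1 => /eqP r0; rewrite -wval_eq0 ESr r0 /=.
  have := wvalP S; rewrite ESr r0 reduced_cat => /and3P[_ _].
  by rewrite /cancels inv_wordK; case: (y) y0 => //= x v _; rewrite eqxx.
have r'0 : r' != [::].
  apply: contra T1 => /eqP r0'; rewrite -[T]eltK ETr r0' elt_cat_conj elt0 conj1g.
  by rewrite eqxx.
have cy v : v != [::] -> cancels y v = cancels (inv_word S) v.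
  by move=> v0; rewrite ESr !inv_word_cat inv_wordK cancels_catl.
have redy : reduced y.
  by have := wvalP S; rewrite ESr => /reduced_catr/reduced_catr.
exists gen_a, gen_b, 1; rewrite ev_a ev_b !conjg1; split=> //; first exact: basis_gen.
right; exists y, r, y', r'; rewrite -ESr -ETr !eltK; split=> //.
have T0 : wval T != [::] by rewrite wval_eq0.
have yT : reduced (y ++ T) by rewrite reduced_cat redy wvalP cy.
have yTV : reduced (y ++ T^-1).
  by rewrite reduced_cat redy wvalP cy // wval_eq0 invg_eq1.
rewrite /barbell y0 r0 r'0 cr cr' -ESr -ETr !wvalP /=.
move: yT yTV; rewrite wval_inv ETr !inv_word_cat inv_wordK !catA.
by do 2!move=> /reduced_catl ->.
Qed.

Lemma normalizable_suffix S T e : injective (ev S T) ->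
  (size S + size T <= n)%N -> wval T = e ++ S -> S != 1 -> normalizable S T.
Proof.
move=> inj le ET S1.
apply: (@normalizable_move S T gen_a (gen_b * gen_a^-1) 1) => //.
  by have := basis_mul (basis_invr (basis_swap basis_gen)) => /basis_swap
     /basis_inv; rewrite invgK.
rewrite !conjg1 evM evV ev_a ev_b.
have -> : T * S^-1 = elt e by rewrite -[T]eltK ET elt_cat eltK mulgK.
rewrite ltn_add2l ET size_cat; apply: leq_ltn_trans (size_elt e) _.
by rewrite -{1}[size e]addn0 ltn_add2l lt0n size_eq0 wval_eq0.
Qed.

(** A common first letter of [e1] and [e2] is moved by conjugation to the end of [e3]: the total
    length is unchanged and [e1] gets shorter. This ends at a theta graph, or with an edge used up,
    and then one word is a suffix of the other and can be divided off. *)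
Lemma normalizable_theta e1 e2 e3 : let S := elt (e1 ++ e3) in
  let T := elt (e2 ++ e3) in
  injective (ev S T) -> (size (e1 ++ e3) + size (e2 ++ e3) <= n)%N ->
  e1 != [::] -> e2 != [::] ->
  reduced (e1 ++ e3 ++ e1) -> reduced (e1 ++ e3 ++ e2) ->
  reduced (e2 ++ e3 ++ e1) -> reduced (e2 ++ e3 ++ e2) ->
  reduced (e1 ++ inv_word e2) -> normalizable S T.
Proof.
move: e1 => e1; have [m] := ubnP (size e1).
elim: m e1 e2 e3 => // m IHm e1 e2 e3 ltm S T inj le e10 e20 r11 r12 r21 r22 rd.
have rS : reduced (e1 ++ e3) by move: r11; rewrite catA => /reduced_catl.
have rT : reduced (e2 ++ e3) by move: r21; rewrite catA => /reduced_catl.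
have [S1 T1] := injective_ev_neq1 inj.
have le' : (size S + size T <= n)%N by rewrite !wval_elt.
case: (boolP (cancels (inv_word e1) e2)) => [|ncd]; last first.
  exists gen_a, gen_b, 1; rewrite ev_a ev_b !conjg1; split=> //; first exact: basis_gen.
  left; exists e1, e2, e3; split=> //.
  rewrite /theta e10 e20 r11 r12 r21 r22 rd /= reduced_cat ncd reduced_inv.
  by rewrite (reduced_catl rS) (reduced_catl rT).
case/cancels_headP=> z [u1 [u2 [E1 E2]]]; rewrite {}E1 {}E2 in ltm S T inj le e10 e20 r11 r12 r21 r22 rd rS rT S1 T1 le' *.
have SE : S ^ lett z = elt (u1 ++ e3 ++ [:: z]) by rewrite /S elt_rot1 -catA.
have TE : T ^ lett z = elt (u2 ++ e3 ++ [:: z]) by rewrite /T elt_rot1 -catA.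
have tl (a b : word) : reduced ((z :: a) ++ e3 ++ z :: b) -> reduced (a ++ (e3 ++ [:: z]) ++ b).
  by rewrite cat_cons reduced_cons -!catA cat1s => /andP[].
have s11 : reduced (u1 ++ e3 ++ [:: z]).
  by have := tl _ _ r11; rewrite catA => /reduced_catl.
have s21 : reduced (u2 ++ e3 ++ [:: z]).
  by have := tl _ _ r21; rewrite catA => /reduced_catl.
have inj' : injective (ev (S ^ lett z) (T ^ lett z)).
  by have := @injective_step S T gen_a gen_b (lett z) basis_gen inj; rewrite ev_a ev_b.
have sz : (size (S ^ lett z)%g + size (T ^ lett z)%g = size S + size T)%N.
  by rewrite SE TE (wval_elt s11) (wval_elt s21) (wval_elt rS) (wval_elt rT) !size_cat /= ?size_cat; clear; lia.
apply: (@normalizable_step S T gen_a gen_b (lett z) basis_gen); rewrite ev_a ev_b ?sz //.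
have [S1' T1'] := injective_ev_neq1 inj'.
have [u10|u10] := eqVneq u1 [::].
  apply: (@normalizable_suffix _ _ u2) => //; first by rewrite sz.
  by rewrite u10 in SE s11; rewrite SE TE !wval_elt.
have [u20|u20] := eqVneq u2 [::].
  apply: normalizable_swap; apply: (@normalizable_suffix _ _ u1) => //.
  - have := @injective_step S T gen_b gen_a (lett z) (basis_swap basis_gen) inj.
    by rewrite ev_a ev_b.
  - by rewrite addnC sz.
  by rewrite u20 in TE s21; rewrite SE TE !wval_elt.
rewrite SE TE in inj' *.
apply: (IHm u1 u2 (e3 ++ [:: z])) => //; try exact: tl.
  by move: le; clear; rewrite /= !size_cat /=; lia.
move: rd; rewrite -[z :: u2]cat1s inv_word_cat catA => /reduced_catl.
by rewrite cat_cons reduced_cons => /andP[].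
Qed.

Lemma normalizable_coherent S T : injective (ev S T) ->
  (size S + size T <= n)%N -> reduced (S ++ S) -> reduced (S ++ T) ->
  reduced (T ++ S) -> reduced (T ++ T) -> normalizable S T.
Proof.
move=> inj le rSS rST rTS rTT; have [S1 T1] := injective_ev_neq1 inj.
have [e1 [e2 [e3 [ES ET /or3P[/eqP e10|/eqP e20|nc]]]]] := common_suffix S T.
- by apply: (@normalizable_suffix _ _ e2) => //; rewrite ET ES e10.
- apply: normalizable_swap; apply: (@normalizable_suffix _ _ e1) => //.
  + have := @injective_step S T gen_b gen_a 1 (basis_swap basis_gen) inj.
    by rewrite ev_a ev_b !conjg1.
  + by rewrite addnC.
  + by rewrite ET ES e20.
have [e10|e10] := eqVneq e1 [::].
  by apply: (@normalizable_suffix _ _ e2) => //; rewrite ET ES e10.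
have [e20|e20] := eqVneq e2 [::].
  apply: normalizable_swap; apply: (@normalizable_suffix _ _ e1) => //.
  + have := @injective_step S T gen_b gen_a 1 (basis_swap basis_gen) inj.
    by rewrite ev_a ev_b !conjg1.
  + by rewrite addnC.
  + by rewrite ET ES e20.
have infix (u v : word) : reduced ((u ++ e3) ++ v ++ e3) -> reduced (u ++ e3 ++ v).
  by rewrite catA => /reduced_catl; rewrite -catA.
rewrite ES ET in rSS rST rTS rTT le; rewrite -[S]eltK -[T]eltK ES ET.
apply: normalizable_theta => //; try exact: infix.
  by rewrite -ES -ET !eltK.
rewrite reduced_cat reduced_inv nc andbT.
by rewrite (reduced_catl (reduced_catl rSS)) (reduced_catl (reduced_catl rTT)).
Qed.

End Induction.

Theorem injective_normalizable S T : injective (ev S T) -> normalizable S T.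
Proof.
have [n] := ubnP (size S + size T)%N; elim: n S T => // n IH S T lt inj.
have IHn := fun S T i l => IH S T l i.
have le : (size S + size T <= n)%N by [].
case: (boolP (cred S)) => [cS|]; last exact: (normalizable_noncred IHn).
have inj' : injective (ev T S).
  have := @injective_step S T gen_b gen_a 1 (basis_swap basis_gen) inj.
  by rewrite ev_a ev_b !conjg1.
case: (boolP (cred T)) => [cT|ncT]; last first.
  by apply: normalizable_swap; apply: (normalizable_noncred IHn) => //; rewrite addnC.
case: (boolP (cancels S T || cancels T S)) => [c|]; last first.
  rewrite negb_or => /andP[c1 c2]; apply: (normalizable_coherent IHn) => //.
    by rewrite reduced_cat !wvalP.
  by rewrite reduced_cat !wvalP.
(* Since [S] and [T] are cyclically reduced, a cancellation in S T or T S excludes any in S T^-1 and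
   T^-1 S. *)
have cTV : cred T^-1 by rewrite wval_inv /cred -inv_word_cat reduced_inv.
apply: normalizable_inv; apply: (normalizable_coherent IHn) => //.
- have := @injective_step S T gen_a gen_b^-1 1 (basis_invr basis_gen) inj.
  by rewrite ev_a evV ev_b !conjg1.
- by rewrite size_inv.
- rewrite reduced_cat !wvalP wval_inv /=; move: cS cT; rewrite !credE.
  move=> /andP[_ nS] /andP[_ nT]; move: c nS nT; rewrite /cancels.
  case: (ohead (inv_word S)) => [p'|] //; case: (ohead (inv_word T)) => [q'|] //.
  case: (q' =P p') => [->|/eqP]; last by rewrite eq_sym => /negPf /= ->.
  by case: (ohead S) => [p|]; case: (ohead T) => [q|] //; do 2?case: eqP.
- rewrite reduced_cat !wvalP wval_inv /=; move: cS cT; rewrite !credE.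
  move=> /andP[_ nS] /andP[_ nT]; move: c nS nT; rewrite /cancels !inv_wordK.
  case: (ohead S) => [p|] //; case: (ohead T) => [q|] //.
  case: (q =P p) => [->|_] //.
  by case: (ohead (inv_word S)) => [p'|]; case: (ohead (inv_word T)) => [q'|] //;
      do 2?case: eqP.
Qed.

(** * Outer fixed elements are powers of primitive elements *)

Definition primitive_power (g : F2) : Prop :=
  exists s t k, basis s t /\ g = s ^+ k.

Lemma primitive_power_conj g h : conjugate g h -> primitive_power g -> primitive_power h.
Proof.
by case=> x -> [s [t [k [b ->]]]]; exists (s ^ x), (t ^ x), k; rewrite conjXg;
  split=> //; exact: basis_conj.
Qed.

Lemma primitive_power_ev s t g : basis s t -> primitive_power g ->
  primitive_power (ev s t g).
Proof.
by move=> b [x [y [k [b' ->]]]]; exists (ev s t x), (ev s t y), k; rewrite evX;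
  split=> //; exact: basis_ev.
Qed.

Lemma basis_lett x y : x.1 != y.1 -> basis (lett x) (lett y).
Proof.
have b0 : basis (lett (false, false)) (lett (true, false)) by exact: basis_gen.
have E c : lett (c, true) = (lett (c, false))^-1 by rewrite -lett_inv.
case: x y => [[] []] [[] []] //= _; rewrite ?E;
  repeat first [exact: b0 | exact: basis_swap b0 | apply: basis_inv | apply: basis_invr].
Qed.

Lemma reduced_single c w : reduced w -> all (fun x => x.1 == c) w ->
  exists x, w = nseq (size w) x.
Proof.
elim: w => [|x w IHw] red; first by exists (c, false).
case/andP=> /eqP xc wc; have := red; rewrite reduced_cons => /andP[rw nc].
exists x; congr (_ :: _); have [y Ew] := IHw rw wc.
case: w Ew wc nc {IHw red rw} => [|z w] //= [<- Ew] /andP[/eqP zc _].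
rewrite /cancels /= => nc.
suff Ezx : z = x by rewrite -Ezx; congr (_ :: _); exact: Ew.
case: z x zc xc nc {Ew} => [u v] [u' v'] /= -> ->; rewrite /letter_inv /=.
by case: v; case: v' => //; rewrite eqxx.
Qed.

Lemma elt_nseq k x : elt (nseq k x) = lett x ^+ k.
Proof. by elim: k => // k IHk; rewrite /= elt_cons IHk expgS. Qed.

Lemma primitive_power_single c w : reduced w -> all (fun x => x.1 == c) w ->
  primitive_power (elt w).
Proof.
move=> red sw; have [x ->] := reduced_single red sw.
exists (lett x), (lett (~~ x.1, false)), (size w); rewrite elt_nseq; split=> //.
by apply: basis_lett; case: (x.1).
Qed.

Lemma adjacent_change (p : letter -> bool) w :
  all (fun x => p x) w \/ all (fun x => ~~ p x) w \/
  exists u x y v, w = u ++ [:: x, y & v] /\ p x != p y.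
Proof.
elim: w => [|x w [IHw|[IHw|[u [y [z [v [-> H]]]]]]]]; first by left.
- case px: (p x); first by left; rewrite /= px.
  case: w IHw => [|y w] /=; first by right; left; rewrite px.
  by case/andP=> py _; right; right; exists [::], x, y, w; rewrite px py.
- case px: (p x); last by right; left; rewrite /= px.
  case: w IHw => [|y w] /=; first by left; rewrite px.
  by case/andP=> py _; right; right; exists [::], x, y, w; rewrite px (negPf py).
- by right; right; exists (x :: u), y, z, v.
Qed.

(** In a reduced word a change of sign forces a change of generator, so the first two letters
    determine all others. The condition on the last letter makes the length even. *)
Lemma alternating_word z z' w : z.2 != z'.2 -> z.1 != z'.1 ->
  reduced (z :: z' :: w) ->
  (forall u x y v, z :: z' :: w = u ++ [:: x, y & v] -> x.2 != y.2) ->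
  (last z' w).2 != z.2 -> exists k, z :: z' :: w = flatten (nseq k [:: z; z']).
Proof.
move=> s1 g1; have [n] := ubnP (size w); elim: n w => // n IHn.
case=> [|x [|y w]] lt red alt la; first by exists 1%N.
  have := alt [:: z] z' x [::] erefl; move: la s1 => /=.
  by case: (x.2) (z.2) (z'.2) => [] [] [].
have a1 : z'.2 != x.2 by exact: (alt [:: z] z' x (y :: w)).
have a2 : x.2 != y.2 by exact: (alt [:: z; z'] x y w).
have red2 : reduced (z' :: x :: y :: w) by move: red; rewrite -cat1s => /reduced_catr.
have red3 : reduced (x :: y :: w) by move: red2; rewrite -cat1s => /reduced_catr.
have nx : x != letter_inv z' by move: red2 => /= /andP[].
have ny : y != letter_inv x by move: red3 => /= /andP[].
have Ex : x = z.
  by clear - nx a1 s1 g1; case: x z z' nx a1 s1 g1 => [[] []] [[] []] [[] []].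
rewrite {}Ex in ny a2 nx a1 red red2 red3 alt la *.
have Ey : y = z'.
  by clear - ny a2 s1 g1; case: y z z' ny a2 s1 g1 => [[] []] [[] []] [[] []].
rewrite {}Ey in red3 alt la *.
have lw : (size w < n)%N by move: lt; clear; rewrite /=; lia.
have alt' u x' y' v : z :: z' :: w = u ++ [:: x', y' & v] -> x'.2 != y'.2.
  by move=> E; apply: (alt (z :: z' :: u) x' y' v); rewrite E.
by have [k ->] := IHn w lw red3 alt' la; exists k.+1.
Qed.

Lemma mem_gen_change c (w : word) : ~~ all (fun x => x.1 == ~~ c) w ->
  exists2 x, x \in w & x.1 = c.
Proof.
rewrite -has_predC => /hasP[x xw /= xc]; exists x => //.
by move: xc; case: (x.1) c => [] [].
Qed.

Lemma size1P (w : word) : w != [::] -> ~~ (1 < size w)%N -> exists x, w = [:: x].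
Proof. by case: w => [|x [|]] //; exists x. Qed.

Section ThetaTrace.
Variables (e1 e2 e3 : word).
Hypothesis th : theta e1 e2 e3.

Lemma theta_edge_neq0 x : theta_edge e1 e2 x != [::].
Proof.
case/and5P: th => e10 e20 _ _ _.
by case: x => [[] []]; rewrite /theta_edge /= ?inv_word_eq0.
Qed.

Lemma theta_edge_size x : size (theta_edge e1 e2 x) = size (if x.1 then e2 else e1).
Proof. by case: x => [[] []]; rewrite /theta_edge /= ?size_inv_word. Qed.

(** Without growth [e1] and [e2] are single letters. If [e3] is not empty, the sign must moreover
    change at every step of the cyclic word, which is then a power of a product of two letters. *)
Lemma theta_trace_size z w :
  cred (z :: w) -> ~~ all (fun x => x.1 == false) (z :: w) ->
  ~~ all (fun x => x.1 == true) (z :: w) ->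
  [\/ (size (z :: w) < size (trace (theta_edge e1 e2) (theta_glue e3) (z :: w) z))%N,
    primitive_power (elt (z :: w)) |
    exists c d, [/\ c.1 != d.1, e1 = [:: c], e2 = [:: d] & e3 = [::]]].
Proof.
move=> cw na nb.
have [x0 x0w x01] := @mem_gen_change false _ nb.
have [x1 x1w x11] := @mem_gen_change true _ na.
have := th; case/and5P=> e10 e20 _ r12 /and4P[_ _ rd rd'].
case: (boolP (1 < size e1)%N) => [s1|/(size1P e10)[c Ec]].
  constructor 1; apply: (size_trace_lt _ theta_edge_neq0 _ x0w).
  by rewrite theta_edge_size x01.
case: (boolP (1 < size e2)%N) => [s2|/(size1P e20)[d Ed]].
  constructor 1; apply: (size_trace_lt _ theta_edge_neq0 _ x1w).
  by rewrite theta_edge_size x11.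
have [e30|e30] := eqVneq e3 [::].
  constructor 3; exists c, d; split=> //; move: rd r12; rewrite Ec Ed e30 /=.
  by rewrite !andbT; clear; case: c d => [[] []] [[] []].
have g0 x y : x.2 = y.2 -> theta_glue e3 x y != [::].
  by move=> xy; rewrite /theta_glue xy eqxx; case: (y.2); rewrite /= ?inv_word_eq0.
have red := cred_reduced cw.
have [H|alt] := pselect (exists u x y v, z :: w = u ++ [:: x, y & v] /\ x.2 = y.2).
  have [u [x [y [v [E xy]]]]] := H; constructor 1; rewrite E.
  by apply: size_trace_glue; [exact: theta_edge_neq0 | exact: g0].
have {}alt u x y v : z :: w = u ++ [:: x, y & v] -> x.2 != y.2.
  by move=> E; apply/eqP => xy; apply: alt; exists u, x, y, v.
(* The same argument applies where the cyclic word closes. *)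
have [la|la] := eqVneq (last z w).2 z.2.
  constructor 1; rewrite lastI -cats1 trace_cat /= cats0 !size_cat /= addn1.
  have : (0 < size (theta_glue e3 (last z w) z))%N by rewrite lt0n size_eq0; exact: g0.
  have : (0 < size (theta_edge e1 e2 (last z w)))%N by rewrite lt0n size_eq0 theta_edge_neq0.
  have := size_trace (theta_glue e3) theta_edge_neq0 (belast z w) (last z w).
  by clear; lia.
constructor 2; case: w cw na nb x0w x1w red alt la => [|z' w] cw na nb x0w x1w red alt la.
  by rewrite eqxx in la.
have s1 : z.2 != z'.2 by exact: (alt [::] z z' w).
have nz : z' != letter_inv z by move: red => /= /andP[].
have g1 : z.1 != z'.1.
  by clear - s1 nz; case: z z' s1 nz => [[] []] [[] []].
have [k ->] := alternating_word s1 g1 red alt la.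
rewrite elt_flatten_nseq; exists (lett z * lett z'), (lett z'), k; split.
  by apply: basis_mul; exact: basis_lett.
by rewrite -cat1s elt_cat.
Qed.

End ThetaTrace.

Lemma barbell_trace_glue y r y' r' z w : barbell y r y' r' ->
  ~~ all (fun x => x.1 == false) (z :: w) -> ~~ all (fun x => x.1 == true) (z :: w) ->
  exists u x x' v, [/\ z :: w = u ++ [:: x, x' & v], x.1 != x'.1 &
    barbell_glue y y' x x' != [::]].
Proof.
case/and5P=> y0 _ _ _ _ na nb.
have [H|[H|[u [x [x' [v [E xx']]]]]]] := adjacent_change (fun x => x.1) (z :: w).
- by case/negP: nb; apply: sub_all H => x /= ->.
- by case/negP: na; apply: sub_all H => x /= /negPf ->.
exists u, x, x', v; split=> //; rewrite /barbell_glue (negPf xx').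
by case: ifP => _; rewrite -size_eq0 size_cat addn_eq0 !size_eq0 inv_word_eq0 (negPf y0) ?andbF.
Qed.

Lemma barbell_edge_neq0 y r y' r' x : barbell y r y' r' -> barbell_edge r r' x != [::].
Proof.
case/and5P=> _ r0 r0' _ _.
by case: x => [[] []]; rewrite /barbell_edge /= ?inv_word_eq0.
Qed.

Lemma normal_form_surjective A B s t g c d : c.1 != d.1 ->
  ev A B s ^ g = lett c -> ev A B t ^ g = lett d ->
  forall y : F2, exists x : F2, ev A B x = y.
Proof.
move=> cd Ec Ed y.
have [p [q [_ _ c2]]] := basis_bij (basis_lett cd).
have := c2 (y ^ g); rewrite -Ec -Ed ev_conj => /conjg_inj; rewrite -ev_ev => <-.
by eexists.
Qed.

Theorem fixed_primitive_power A B r : injective (ev A B) ->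
  ~ (forall y : F2, exists x : F2, ev A B x = y) ->
  cred r -> conjugate (ev A B (elt r)) (elt r) -> primitive_power (elt r).
Proof.
have [n] := ubnP (size r); elim: n A B r => // n IHn A B r lt inj nsurj cr fix_r.
have [s [t [g [bst nf _]]]] := injective_normalizable inj.
have [p [q [bpq c1 c2]]] := basis_bij bst.
have [W [y [cW _ WW0]]] := exists_cred (wvalP (ev p q (elt r))).
rewrite eltK in WW0.
have Wr : conjugate (ev s t (elt W)) (elt r).
  by have := conjugate_ev s t WW0; rewrite c2.
suff : primitive_power (elt W).
  by move=> pW; apply: primitive_power_conj Wr _; exact: primitive_power_ev.
case: (boolP (all (fun x => x.1 == false) W)) => [/primitive_power_single|na].
  by apply; exact: cred_reduced.
case: (boolP (all (fun x => x.1 == true) W)) => [/primitive_power_single|nb].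
  by apply; exact: cred_reduced.
have WrA : conjugate (ev (ev A B s ^ g) (ev A B t ^ g) (elt W)) (elt r).
  rewrite ev_conj -ev_ev; apply: conjugate_trans fix_r.
  apply: conjugate_trans (conjugate_sym (conjugateJ _ _)) _.
  exact: conjugate_ev.
suff [lW|//] : (size W < size r)%N \/ primitive_power (elt W).
  (* [f] is the given map read in the basis (s, t); [W] is an outer fixed word of it. *)
  pose f x := ev p q (ev A B (ev s t x)).
  have fE : f =1 ev (ev p q (ev A B s)) (ev p q (ev A B t)).
    by move=> x; rewrite /f !ev_ev.
  apply: (IHn (ev p q (ev A B s)) (ev p q (ev A B t))) => //.
  - exact: leq_trans lW _.
  - by move=> x x'; rewrite -!fE => /(can_inj c2)/inj/(can_inj c1).
  - move=> surj; apply: nsurj => x; have [x' Ex] := surj (ev p q x).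
    by exists (ev s t x'); move: Ex; rewrite -fE => /(can_inj c2).
  - rewrite -fE /f; apply: conjugate_trans (conjugate_sym WW0).
    apply: conjugate_ev; apply: conjugate_trans fix_r; exact: conjugate_ev.
case: W cW na nb WrA {WW0 Wr} => [|z w] // cW na nb WrA.
case: nf => [[e1 [e2 [e3 [th ES ET]]]]|[y0 [r0 [y0' [r0' [bb ES ET]]]]]].
  have [cC CW] := theta_trace th cW; rewrite -ES -ET in CW.
  (* The trace of [W] and [r] are cyclically reduced and conjugate, hence of equal length; growth of
     the trace therefore means that [W] is shorter than [r]. *)
  have sC := rotation_size (cred_conj_cred cC cr (conjugate_trans (conjugate_sym CW) WrA)).
  have [H|H|[c [d [cd Ec Ed E3]]]] := theta_trace_size th cW na nb.
  - by left; rewrite sC.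
  - by right.
  case: nsurj; apply: (@normal_form_surjective A B s t g c d cd).
    by rewrite ES Ec E3.
  by rewrite ET Ed E3.
have [cC CW] := barbell_trace bb cW; rewrite -ES -ET in CW.
have sC := rotation_size (cred_conj_cred cC cr (conjugate_trans (conjugate_sym CW) WrA)).
have [u [x [x' [v [E _ gl]]]]] := barbell_trace_glue bb na nb.
left; rewrite sC E; apply: size_trace_glue gl => a; exact: barbell_edge_neq0 bb.
Qed.

(** * The length of outer fixed elements *)

Definition letter_sign (x : letter) : int := if x.2 then (-1)%R else 1%R.

Lemma positive_expo x y w : x.1 != y.1 -> positive x y w ->
  [/\ word_expo x.1 w = (letter_sign x * (count_mem x w)%:Z)%R,
     word_expo y.1 w = (letter_sign y * (count_mem y w)%:Z)%R &
     size w = (count_mem x w + count_mem y w)%N].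
Proof.
move=> xy; have xny : x != y by apply: contra xy => /eqP->.
have ynx : y != x by rewrite eq_sym.
elim: w => [|z w IHw]; first by rewrite /letter_sign /=; split=> //; case: ifP.
case/andP=> zxy /IHw[E1 E2 E3]; rewrite /= E1 E2 E3 {E1 E2 E3 IHw}.
case/orP: zxy => /eqP ->; rewrite /letter_expo !eqxx ?(negPf xny) ?(negPf ynx).
  rewrite (negPf xy) /letter_sign; move: (count_mem x w) (count_mem y w) => m n.
  by clear; case: (x.2); case: (y.2); split; lia.
rewrite [y.1 == _]eq_sym (negPf xy) /letter_sign.
move: (count_mem x w) (count_mem y w) => m n.
by clear; case: (x.2); case: (y.2); split; lia.
Qed.

Lemma positive_size x y w : x.1 != y.1 -> positive x y w ->
  size w = (`|word_expo false w| + `|word_expo true w|)%N.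
Proof.
move=> xy /(positive_expo xy)[]; rewrite /letter_sign.
case: x y xy => [[] []] [[] []] //= _; lia.
Qed.

Lemma positive_basis_basis X Y P Q :
  basis X Y -> positive_basis X Y P Q -> basis P Q.
Proof.
move=> b; elim=> {P Q} // P Q _ IH; first exact: basis_mul.
have := basis_conj P^-1 (basis_mulr IH).
have -> : P ^ P^-1 = P by rewrite conjgE mulgV mulg1 invgK.
by have -> : (Q * P) ^ P^-1 = P * Q by rewrite conjgE mulgK invgK.
Qed.

Lemma positive_basis_ev S T X Y P Q : positive_basis X Y P Q ->
  positive_basis (ev S T X) (ev S T Y) (ev S T P) (ev S T Q).
Proof.
elim=> {P Q} [|P Q _ IH|P Q _ IH]; first exact: positive_basis_refl.
  by rewrite evM; exact: positive_basis_mull.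
by rewrite evM; exact: positive_basis_mulr.
Qed.

(** Moves that change only the second member are skipped; the last move that changed the first
    member displays it as a product. *)
Lemma positive_basis_fst X Y P Q : positive_basis X Y P Q ->
  P = X \/ exists s t, positive_basis X Y s t /\ P = s * t.
Proof.
elim=> {P Q} [|P Q H _|P Q _ IH] //; first by left.
by right; exists P, Q.
Qed.

(** The inductive definition exposes the last move. The first one is needed in [theta_opposite],
    because it absorbs the cancellation between the two images. *)
Lemma positive_basis_first_move X Y P Q : positive_basis X Y P Q ->
  [\/ P = X /\ Q = Y, positive_basis (X * Y) Y P Q | positive_basis X (X * Y) P Q].
Proof.
elim=> {P Q} [|P Q _ [[-> ->]|H|H]|P Q _ [[-> ->]|H|H]]; first by constructor 1.
- by constructor 2; exact: positive_basis_refl.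
- by constructor 2; exact: positive_basis_mull.
- by constructor 3; exact: positive_basis_mull.
- by constructor 3; exact: positive_basis_refl.
- by constructor 2; exact: positive_basis_mulr.
- by constructor 3; exact: positive_basis_mulr.
Qed.

(** The last move makes one of the two words contain the other. *)
Lemma positive_basis_common_letter x y P Q : x.1 != y.1 ->
  positive_basis (lett x) (lett y) P Q ->
  (P = lett x /\ Q = lett y) \/ exists2 z, z \in wval P & z \in wval Q.
Proof.
move=> xy; case=> {P Q} [|P Q PQ|P Q PQ]; first by left.
  have [pP pQ _ Q0 _] := positive_basis_words xy PQ; right.
  rewrite (positive_mul xy pP pQ).
  case: (wval Q) Q0 => // z w _; exists z; rewrite ?mem_cat ?mem_head //.
  by rewrite orbT.
have [pP pQ P0 _ _] := positive_basis_words xy PQ; right.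
rewrite (positive_mul xy pP pQ).
by case: (wval P) P0 => // z w _; exists z; rewrite ?mem_cat ?mem_head.
Qed.

(** All positive products of such words are reduced as they stand. *)
Definition coherent (S T : word) : bool :=
  [&& S != [::], T != [::], reduced (S ++ S), reduced (S ++ T), reduced (T ++ S)
    & reduced (T ++ T)].

Lemma coherent_mull S T : coherent S T -> coherent (S ++ T) T.
Proof.
case/and5P=> S0 T0 SS ST /andP[TS TT].
have STT : reduced (S ++ T ++ T) by exact: reduced_overlap.
have STS : reduced (S ++ T ++ S) by exact: reduced_overlap.
have TST : reduced (T ++ S ++ T) by exact: reduced_overlap.
have STST : reduced (S ++ T ++ S ++ T) by exact: reduced_overlap.
rewrite /coherent -!catA STST STT TST TT T0 !andbT.
by case: (S) S0.
Qed.

Lemma coherent_sym S T : coherent S T -> coherent T S.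
Proof.
by case/and5P=> S0 T0 SS ST /andP[TS TT]; rewrite /coherent S0 T0 SS ST TS TT.
Qed.

Lemma coherent_mulr S T : coherent S T -> coherent S (S ++ T).
Proof.
case/and5P=> S0 T0 SS ST /andP[TS TT].
have SST : reduced (S ++ S ++ T) by exact: reduced_overlap.
have STS : reduced (S ++ T ++ S) by exact: reduced_overlap.
have TST : reduced (T ++ S ++ T) by exact: reduced_overlap.
have STST : reduced (S ++ T ++ S ++ T) by exact: reduced_overlap.
rewrite /coherent -!catA SS SST STS STST S0 !andbT.
by case: (S) S0.
Qed.

Lemma positive_basis_coherent S T P Q : coherent S T ->
  positive_basis (elt S) (elt T) P Q ->
  exists p q, [/\ coherent p q, P = elt p & Q = elt q].
Proof.
move=> cST; elim=> {P Q} [|P Q _ [p [q [c -> ->]]]|P Q _ [p [q [c -> ->]]]].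
- by exists S, T.
- by exists (p ++ q), q; rewrite elt_cat; split=> //; exact: coherent_mull.
- by exists p, (p ++ q); rewrite elt_cat; split=> //; exact: coherent_mulr.
Qed.

Lemma coherent_prefix c u v : c != [::] -> reduced (c ++ u ++ c) ->
  reduced (c ++ v ++ c) -> coherent (c ++ u) (c ++ v).
Proof.
move=> c0 ru rv.
have H a b : reduced (c ++ a ++ c) -> reduced (c ++ b ++ c) ->
    reduced ((c ++ a) ++ c ++ b).
  rewrite catA => ra; rewrite catA => /reduced_catl rb; exact: reduced_overlap.
by apply/and5P; split; try exact: H; [case: (c) c0 | case: (c) c0 | apply/andP; split; exact: H].
Qed.

Lemma coherent_suffix c u v : c != [::] -> reduced (c ++ u ++ c) ->
  reduced (c ++ v ++ c) -> coherent (u ++ c) (v ++ c).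
Proof.
move=> c0 ru rv.
have H a b : reduced (c ++ a ++ c) -> reduced (c ++ b ++ c) ->
    reduced ((a ++ c) ++ b ++ c).
  move=> /reduced_catr ra rb; rewrite -catA; exact: reduced_overlap.
by apply/and5P; split; try exact: H; rewrite -?size_eq0 ?size_cat ?addn_eq0
  ?size_eq0 ?(negPf c0) ?andbF //; apply/andP; split; exact: H.
Qed.

Lemma coherent_cred p q : coherent p q -> cred (p ++ q).
Proof. by move/coherent_mull/and5P=> [_ _ ? _ _]. Qed.

Lemma theta_sym e1 e2 e3 : theta e1 e2 e3 -> theta e2 e1 e3.
Proof.
case/and5P=> e10 e20 r11 r12 /and4P[r21 r22 rd rd'].
rewrite /theta e10 e20 r11 r12 r21 r22 -[reduced (e2 ++ _)]reduced_inv.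
by rewrite inv_word_cat inv_wordK rd -reduced_inv inv_word_cat inv_wordK rd'.
Qed.

Section ThetaCoherent.
Variables e1 e2 e3 : word.
Hypothesis th : theta e1 e2 e3.

Lemma theta_coherent : coherent (e1 ++ e3) (e2 ++ e3).
Proof.
case/and5P: th => e10 e20 r11 r12 /and4P[r21 r22 rd rd'].
have H a b : a != [::] -> b != [::] -> reduced (a ++ e3 ++ b) ->
    reduced (b ++ e3 ++ b) -> reduced ((a ++ e3) ++ b ++ e3).
  move=> a0 b0 rab; rewrite [b ++ _]catA => /reduced_catl rb.
  by rewrite catA in rab; exact: reduced_overlap b0 rab rb.
apply/and5P; split; try exact: H; last by apply/andP; split; exact: H.
  by case: (e1) e10.
by case: (e2) e20.
Qed.

Lemma theta_neq0 : e1 != [::] /\ inv_word e2 != [::].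
Proof. by case/and5P: th; rewrite inv_word_eq0. Qed.

Lemma theta_reduced : [/\ reduced (e1 ++ e3 ++ e1), reduced (e1 ++ inv_word e2 ++ e1),
  reduced (inv_word e2 ++ e1 ++ inv_word e2) &
  reduced (inv_word e2 ++ inv_word e3 ++ inv_word e2)].
Proof.
have [e10 e20] := theta_neq0.
case/and5P: th => _ _ r11 _ /and4P[_ r22 rd rd'].
have rdV : reduced (inv_word e2 ++ e1).
  by rewrite -reduced_inv inv_word_cat inv_wordK.
split=> //; try exact: reduced_overlap.
by move: r22; rewrite -reduced_inv !inv_word_cat -catA.
Qed.

(** The path [e3] cancels in S T^-1 = e1 e2^-1. After the first move the two words share the suffix
    e2^-1 or the prefix e1, and nothing cancels any more. *)
Lemma theta_opposite P Q :
  positive_basis (elt (e1 ++ e3)) (elt (e2 ++ e3))^-1 P Q ->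
  (P = elt (e1 ++ e3) /\ Q = (elt (e2 ++ e3))^-1) \/
  exists h p q, [/\ coherent p q, P ^ h = elt p & Q ^ h = elt q].
Proof.
have [e10 e20] := theta_neq0; have [r1 r2 r3 r4] := theta_reduced.
have E : elt (e1 ++ e3) * (elt (e2 ++ e3))^-1 = elt (e1 ++ inv_word e2).
  by rewrite !elt_cat invgM !mulgA mulgK elt_inv.
case/positive_basis_first_move; rewrite ?E => H; first by left.
  right; exists 1; rewrite !conjg1; rewrite -elt_inv inv_word_cat in H.
  by apply: positive_basis_coherent H; exact: coherent_suffix.
by right; exists 1; rewrite !conjg1; apply: positive_basis_coherent H;
  exact: coherent_prefix.
Qed.

(** In this order the product is e3^-1 e2^-1 e1 e3; conjugation by e3^-1 frees it of [e3], and the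
    argument of [theta_opposite] applies. *)
Lemma theta_opposite_swap P Q :
  positive_basis (elt (e2 ++ e3))^-1 (elt (e1 ++ e3)) P Q ->
  (P = (elt (e2 ++ e3))^-1 /\ Q = elt (e1 ++ e3)) \/
  exists h p q, [/\ coherent p q, P ^ h = elt p & Q ^ h = elt q].
Proof.
have [e10 e20] := theta_neq0; have [r1 r2 r3 r4] := theta_reduced.
have EX : (elt (e2 ++ e3))^-1 ^ (elt e3)^-1 = elt (inv_word e2 ++ inv_word e3).
  by rewrite !elt_cat invgM conjgE invgK !elt_inv !mulgA mulgV mul1g.
have EY : elt (e1 ++ e3) ^ (elt e3)^-1 = elt (e3 ++ e1).
  by rewrite !elt_cat conjgE invgK mulgK.
have E : ((elt (e2 ++ e3))^-1 * elt (e1 ++ e3)) ^ (elt e3)^-1 = elt (inv_word e2 ++ e1).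
  by rewrite conjMg EX EY !elt_cat !elt_inv !mulgA mulgVK.
case/positive_basis_first_move => H; first by left.
  right; exists (elt e3)^-1; have := positive_basis_conj (elt e3)^-1 H.
  by rewrite E EY; apply: positive_basis_coherent; exact: coherent_suffix.
right; exists (elt e3)^-1; have := positive_basis_conj (elt e3)^-1 H.
by rewrite E EX; apply: positive_basis_coherent; exact: coherent_prefix.
Qed.

End ThetaCoherent.

Lemma coherent_inv S T : coherent S T -> coherent (inv_word S) (inv_word T).
Proof.
case/and5P=> S0 T0 SS ST /andP[TS TT].
by rewrite /coherent !inv_word_eq0 S0 T0 -!inv_word_cat !reduced_inv SS ST TS TT.
Qed.

Lemma theta_positive e1 e2 e3 x y P Q : theta e1 e2 e3 -> x.1 != y.1 ->
  let f := ev (elt (e1 ++ e3)) (elt (e2 ++ e3)) in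
  positive_basis (lett x) (lett y) P Q ->
  (f P = f (lett x) /\ f Q = f (lett y)) \/
  exists h p q, [/\ coherent p q, f P ^ h = elt p & f Q ^ h = elt q].
Proof.
move=> th xy f; set S := elt (e1 ++ e3); set T := elt (e2 ++ e3).
move/(positive_basis_ev S T); rewrite -/f.
have cST := theta_coherent th; have cSTV := coherent_inv cST.
have coh p q P' Q' : coherent p q -> positive_basis (elt p) (elt q) P' Q' ->
    exists h p q, [/\ coherent p q, P' ^ h = elt p & Q' ^ h = elt q].
  by move=> c H; exists 1; rewrite !conjg1; exact: positive_basis_coherent H.
rewrite /f !ev_lett; case: x y xy => [[] []] [[] []] // _; rewrite /letter_ev /=.
- rewrite -!elt_inv => H; right; apply: coh H; exact: coherent_sym.
- exact: theta_opposite_swap.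
- exact: (theta_opposite (theta_sym th)).
- move=> H; right; apply: coh H; exact: coherent_sym.
- by rewrite -!elt_inv => H; right; apply: coh H.
- exact: (theta_opposite_swap (theta_sym th)).
- exact: theta_opposite.
- by move=> H; right; apply: coh H.
Qed.

Lemma positive_no_inverse x y w : x.1 != y.1 -> w != [::] ->
  positive x y w -> ~~ positive x y (inv_word w).
Proof.
move=> xy; case: w => // z w _ /andP[/= zxy _].
rewrite -cat1s inv_word_cat positive_cat negb_and; apply/orP; right.
rewrite /positive /= andbT negb_or; case/orP: zxy => /eqP ->.
  rewrite [letter_inv x == x]eq_sym letter_inv_neq /=.
  by apply: contra xy => /eqP <-.
rewrite [letter_inv y == y]eq_sym letter_inv_neq andbT.
by apply: contra xy => /eqP <-.
Qed.

(** A member of a monotone pair is conjugate to a positive word, which is cyclically reduced and so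
    a rotation of [r]. *)
Lemma basis_positive s t r : basis s t -> cred r -> conjugate s (elt r) ->
  exists x y, x.1 != y.1 /\ positive x y r.
Proof.
move=> b cr sr; have [x [y [g [t' [xy H]]]]] : exists x y g t',
    x.1 != y.1 /\ positive_basis (lett x) (lett y) (s ^ g) t'.
  by case: (basis_monotone b) => -[x [y [g [xy H]]]]; exists x, y, g; eexists; split; eauto.
exists x, y; split=> //; have [ps _ _ _ _] := positive_basis_words xy H.
apply: (positive_rotation _ ps); apply: cred_conj_cred cr _.
  exact: (positive_cred xy).
by rewrite eltK; apply: conjugate_trans sr; exact: conjugate_sym (conjugateJ _ _).
Qed.

(** The vector (p, q) is primitive and orthogonal to (m, n), so (m, n) is a non-zero integer
    multiple of (-q, p); up to sign the factor is [k]. *)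
Lemma eigenvector_bound (m n p q u v : int) :
  (m * p + n * q = 0)%R -> (p * v - q * u = 1 \/ p * v - q * u = -1)%R ->
  (m != 0)%R || (n != 0)%R -> (`|p| + `|q| <= `|m| + `|n|)%N.
Proof.
move=> E D mn0; pose k := (n * v + m * u)%R.
have Hn : (n * (p * v - q * u) = p * k - u * (m * p + n * q))%R by rewrite /k; ring.
have Hm : (m * (p * v - q * u) = v * (m * p + n * q) - q * k)%R by rewrite /k; ring.
rewrite {}E in Hn Hm.
have En : n = (p * k)%R \/ n = (- (p * k))%R by case: D Hn => ->; [left | right]; lia.
have Em : m = (q * k)%R \/ m = (- (q * k))%R by case: D Hm => ->; [right | left]; lia.
have k0 : (0 < `|k|)%N.
  by rewrite absz_gt0; apply/eqP => k0; move: mn0 En Em; rewrite k0; lia.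
have -> : (`|n| = `|p| * `|k|)%N by rewrite -abszM; case: En => ->; rewrite ?abszN.
have -> : (`|m| = `|q| * `|k|)%N by rewrite -abszM; case: Em => ->; rewrite ?abszN.
by nia.
Qed.

Lemma fixed_bound_nonid A B s t r : basis s t -> cred r -> conjugate s (elt r) ->
  conjugate (ev A B (elt r)) (elt r) ->
  (exists c g, expo c (ev A B g) != expo c g) ->
  (size r <= size A + size B + 1)%N.
Proof.
move=> b cr sr fr [c [g neq]].
have [x [y [xy pr]]] := basis_positive b cr sr.
rewrite (positive_size xy pr).
have Es d : expo d s = word_expo d r by rewrite (expo_conj d sr) expo_elt.
have D := basis_det b; rewrite /= !Es in D.
have F d : (expo d A * word_expo false r + expo d B * word_expo true r
    = word_expo d r)%R.
  by rewrite -[RHS]expo_elt -(expo_conj d fr) expo_ev !expo_elt.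
have sA := expo_size c A; have sB := expo_size c B.
have D' : (word_expo false r * expo true t - word_expo true r * expo false t = 1 \/
  word_expo false r * expo true t - word_expo true r * expo false t = -1)%R by [].
move: neq; rewrite expo_ev => neq.
(* Row [c] of psi^ab - id is non-zero and kills the exponent vector of [r]. Its diagonal entry is an
   exponent sum minus 1, which costs the summand 1. *)
case: c neq sA sB => neq sA sB.
  apply: leq_trans (@eigenvector_bound (expo true A) (expo true B - 1) _ _ _ _ _ D' _) _.
  - by have := F true; lia.
  - by apply: contraR neq; rewrite negb_or !negbK => /andP[/eqP a0 /eqP b0]; apply/eqP; nia.
  - by rewrite /expo in sA sB *; lia.
apply: leq_trans (@eigenvector_bound (expo false A - 1) (expo false B) _ _ _ _ _ D' _) _.
- by have := F false; lia.
- by apply: contraR neq; rewrite negb_or !negbK => /andP[/eqP a0 /eqP b0]; apply/eqP; nia.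
- by rewrite /expo in sA sB *; lia.
Qed.

Lemma count_mem_gt0 (z : letter) (w : word) : z \in w -> (0 < count_mem z w)%N.
Proof. by rewrite -has_pred1 has_count. Qed.

(** If (P, Q) is monotone, p q is another cutting of its cyclic word and [positive_split_unique]
    applies. If (P, Q^-1) is monotone and not just two letters, [P] and [Q] have exponents of
    opposite sign in a common generator, which the positive word p q does not allow. *)
Lemma positive_pair_rigid x0 y0 (p q r : word) P Q :
  x0.1 != y0.1 -> positive x0 y0 (p ++ q) -> basis P Q -> cred r ->
  conjugate (P * Q) (elt r) -> rotation r (p ++ q) ->
  (forall c, word_expo c p = expo c P) -> (forall c, word_expo c q = expo c Q) ->
  exists m, elt p = P ^ m /\ elt q = Q ^ m.
Proof.
move=> xy0; rewrite positive_cat => /andP[pp pq] bPQ cr PQr rot_r eP eQ.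
have key x1 y1 k : x1.1 != y1.1 ->
    positive_basis (lett x1) (lett y1) (P ^ k) (Q ^ k) ->
    exists m, elt p = P ^ m /\ elt q = Q ^ m.
  move=> xy1 H; have [pP pQ _ _ [u [v [Euv Evu]]]] := positive_basis_words xy1 H.
  have E1 : elt (wval (P ^ k) ++ wval (Q ^ k)) = (P * Q) ^ k.
    by rewrite elt_cat !eltK conjMg.
  have rot1 : rotation (wval (P ^ k) ++ wval (Q ^ k)) (p ++ q).
    apply: rotation_trans rot_r; apply: cred_conj_cred cr _.
      by apply: (positive_cred xy1); rewrite positive_cat pP.
    rewrite E1; apply: conjugate_trans PQr.
    exact: conjugate_sym (conjugateJ _ _).
  have eP' c : word_expo c p = word_expo c (P ^ k).
    by rewrite eP -(expoJ c P k).
  have [|m [-> ->]] := positive_split_unique xy1 Euv Evu rot1 _ eP'.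
    by rewrite (positive_size xy0 pp) (positive_size xy1 pP) !eP'.
  by exists (k * m); rewrite !eltK !conjgM.
case: (basis_monotone bPQ) => -[x1 [y1 [k [xy1 H]]]]; first exact: key H.
case: (positive_basis_common_letter xy1 H) => [[EP EQ]|[z zP zQ]].
  (* A pair of letters stays monotone when one of them is inverted. *)
  apply: (key x1 (letter_inv y1) k) => //.
  rewrite EP lett_inv -EQ conjVg invgK; exact: positive_basis_refl.
have [pP pQ _ _ _] := positive_basis_words xy1 H.
have eP' c : word_expo c p = word_expo c (P ^ k) by rewrite eP -(expoJ c P k).
have eQ' c : word_expo c q = (- word_expo c (Q^-1 ^ k)%g)%R.
  by rewrite eQ -[word_expo _ _]/(expo c (Q^-1 ^ k)) expoJ expoV; lia.
have ppq : positive x0 y0 (p ++ q) by rewrite positive_cat pp.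
(* Lengths of positive words are sums of absolute exponents, so opposite signs would give |p q| <
   |p| + |q|. *)
have := positive_size xy0 ppq; rewrite size_cat !word_expo_cat.
rewrite (positive_size xy0 pp) (positive_size xy0 pq) !eP' !eQ'.
have [p1 p2 _] := positive_expo xy1 pP; have [q1 q2 _] := positive_expo xy1 pQ.
have : (0 < count_mem x1 (P ^ k)%g /\ 0 < count_mem x1 (Q^-1 ^ k)%g \/
        0 < count_mem y1 (P ^ k)%g /\ 0 < count_mem y1 (Q^-1 ^ k)%g)%N.
  have /orP[/eqP<-|/eqP<-] := allP pP z zP; [left | right];
    by rewrite !count_mem_gt0.
move: p1 p2 q1 q2; rewrite /letter_sign.
move: (count_mem x1 (P ^ k)%g) (count_mem x1 (Q^-1 ^ k)%g).
move: (count_mem y1 (P ^ k)%g) (count_mem y1 (Q^-1 ^ k)%g).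
move: (word_expo^~ (P ^ k)%g) (word_expo^~ (Q^-1 ^ k)%g) => f1 f2 n1 n2 n3 n4.
by case: x1 y1 xy1 {H pP pQ key} => [[] []] [[] []] //= _ -> -> -> -> ; clear; lia.
Qed.

Lemma ev_conj_surjective A B P Q m : basis P Q ->
  ev A B P = P ^ m -> ev A B Q = Q ^ m -> forall y : F2, exists x : F2, ev A B x = y.
Proof.
move=> b EP EQ y; have [p [q [_ _ c2]]] := basis_bij b.
exists (ev P Q (ev p q (y ^ m^-1))).
by rewrite ev_ev EP EQ ev_conj c2 conjgKV.
Qed.

(** The conjugate words P Q and Q P contain x x' and x' x at the same place. Their traces are both
    rotations of [w] and together cross the bridge in both directions, so [w] would contain [y] and
    its inverse. *)
Lemma barbell_not_monotone y r y' r' x x' P Q w x0 y0 :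
  barbell y r y' r' -> x.1 != x'.1 -> positive_basis (lett x) (lett x') P Q ->
  conjugate (ev (elt (inv_word y ++ r ++ y)) (elt (inv_word y' ++ r' ++ y')) (P * Q))
    (elt w) -> cred w -> x0.1 != y0.1 -> ~~ positive x0 y0 w.
Proof.
move=> bb xx' PQ cw crw xy0; apply/negP => pw.
have [pP pQ _ _ [u [v [Euv Evu]]]] := positive_basis_words xx' PQ.
set f := ev _ _ in cw.
have glue z z' : positive x x' (u ++ [:: z, z' & v]) ->
    conjugate (f (elt (u ++ [:: z, z' & v]))) (elt w) ->
    positive x0 y0 (barbell_glue y y' z z').
  case Ez: (u ++ [:: z, z' & v]) => [|z1 w1]; first by case: (u) Ez.
  move=> /(positive_cred xx') c1 cw1.
  have [cC CW] := barbell_trace bb c1.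
  have : positive x0 y0 (trace (barbell_edge r r') (barbell_glue y y') (z1 :: w1) z1).
    apply: (positive_rotation _ pw); apply: cred_conj_cred crw cC _.
    exact: conjugate_trans (conjugate_sym cw1) CW.
  rewrite -Ez; have [a [b ->]] := trace_glue (barbell_edge r r') (barbell_glue y y') u z z' v z1.
  by rewrite !positive_cat => /and3P[].
have g1 : positive x0 y0 (barbell_glue y y' x x').
  apply: glue; first by rewrite -[u ++ _]Euv positive_cat pP.
  by rewrite -[u ++ _]Euv elt_cat !eltK.
have g2 : positive x0 y0 (barbell_glue y y' x' x).
  apply: glue; first by rewrite -[u ++ _]Evu positive_cat pQ.
  rewrite -[u ++ _]Evu elt_cat !eltK; apply: conjugate_trans cw; apply: conjugate_ev.
  by exists P^-1; rewrite conjgE invgK mulgK.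
have y0' : y != [::] by case/and5P: bb.
have H : positive x0 y0 y /\ positive x0 y0 (inv_word y).
  move: g1 g2; rewrite /barbell_glue [x'.1 == _]eq_sym (negPf xx').
  by case: (x.1) (x'.1) xx' => [] [] //= _; rewrite !positive_cat => /andP[? ?] /andP[].
by case: H => h; apply/negP; exact: positive_no_inverse.
Qed.

Lemma fixed_bound_id A B t0 r : injective (ev A B) ->
  ~ (forall y : F2, exists x : F2, ev A B x = y) ->
  (forall c g, expo c (ev A B g) = expo c g) ->
  basis (elt r) t0 -> cred r -> conjugate (ev A B (elt r)) (elt r) ->
  (size r <= size A + size B)%N.
Proof.
move=> inj nsurj Mid b cr fr.
have [s [t [g [bst nf le]]]] := injective_normalizable inj.
have [p [q [bpq c1 c2]]] := basis_bij bst.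
have [x [y [h [U [xy H]]]]] : exists x y h U, x.1 != y.1 /\
    positive_basis (lett x) (lett y) (ev p q (elt r) ^ h) U.
  by case: (basis_monotone (basis_ev bpq b)) => -[x [y [h [xy H]]]]; exists x, y, h;
    eexists; split; eauto.
have [x0 [y0 [xy0 pr]]] := basis_positive b cr (conjugate_refl _).
set S := ev A B s ^ g in nf le; set T := ev A B t ^ g in nf le.
have fE z : ev S T z = ev A B (ev s t z) ^ g by rewrite ev_conj -ev_ev.
have WrA : conjugate (ev S T (ev p q (elt r) ^ h)) (elt r).
  rewrite fE evJ c2 evJ -conjgM; apply: conjugate_trans fr.
  exact: conjugate_sym (conjugateJ _ _).
have size_letter z : (size (letter_ev S T z) <= size S + size T)%N.
  have -> : size (letter_ev S T z) = size (if z.1 then T else S).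
    by case: z => [[] []] //; exact: size_inv.
  by case: (z.1); rewrite ?leq_addl ?leq_addr.
(* If the word is conjugate to a letter, its image is one loop of the normal form; otherwise it is
   conjugate to a product P Q. *)
case: (positive_basis_fst H) => [E|[P [Q [PQ E]]]]; rewrite E in WrA.
  apply: leq_trans (cred_conj_size cr (conjugate_sym WrA)) _.
  rewrite ev_lett; exact: leq_trans (size_letter x) le.
case: nf => [[e1 [e2 [e3 [th ES ET]]]]|[z [r1 [z' [r1' [bb ES ET]]]]]]; last first.
  rewrite ES ET in WrA.
  by have := barbell_not_monotone bb xy PQ WrA cr xy0; rewrite pr.
have sz : (size (ev S T P * ev S T Q)%g <= size A + size B)%N ->
    (size r <= size A + size B)%N.
  by apply: leq_trans; rewrite -evM; exact: cred_conj_size cr (conjugate_sym WrA).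
have EST : ev S T = ev (elt (e1 ++ e3)) (elt (e2 ++ e3)) by rewrite ES ET.
case: (theta_positive th xy PQ); rewrite -EST.
  case=> EP EQ; apply: sz; rewrite EP EQ !ev_lett.
  apply: leq_trans (size_mul _ _) _; apply: leq_trans le.
  have sl z : size (letter_ev S T z) = size (if z.1 then T else S).
    by case: z => [[] []] //; exact: size_inv.
  by rewrite !sl; move: xy; case: (x.1); case: (y.1) => // _; rewrite addnC.
case=> k [p' [q' [c EP EQ]]]; case: nsurj.
(* The product of this basis is conjugate to [r], and its images are, up to conjugation, [p'] and
   [q'] with unchanged exponents. Rigidity turns [ev A B] into a conjugation on this basis. *)
have bPQ := basis_ev bst (positive_basis_basis (basis_lett xy) PQ).
have rot_r : rotation r (p' ++ q').
  apply: cred_conj_cred cr (coherent_cred c) _; rewrite elt_cat -EP -EQ -conjMg -evM.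
  exact: conjugate_trans (conjugate_sym WrA) (conjugateJ _ _).
have expE d z : expo d (ev S T z ^ k) = expo d (ev s t z).
  by rewrite expoJ fE expoJ Mid.
have PQr : conjugate (ev s t P * ev s t Q) (elt r).
  by rewrite -evM -E evJ c2; exact: conjugate_sym (conjugateJ _ _).
have [||m [Ep Eq]] := positive_pair_rigid xy0 (positive_rotation rot_r pr) bPQ cr PQr rot_r.
- by move=> d; rewrite -expo_elt -EP expE.
- by move=> d; rewrite -expo_elt -EQ expE.
apply: (@ev_conj_surjective _ _ _ _ (m * k^-1 * g^-1) bPQ); rewrite !conjgM.
  by rewrite -Ep -EP conjgK fE conjgK.
by rewrite -Eq -EQ conjgK fE conjgK.
Qed.

(** * Correctness of the algorithm *)

Lemma elt_reduce w w' : (reduce w == reduce w') = (elt w == elt w').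
Proof. by []. Qed.

Lemma elt_subst u v w : elt (subst u v w) = ev (elt u) (elt v) (elt w).
Proof.
rewrite ev_elt; elim: w => // x w IHw.
rewrite /subst /= -/(subst u v w) elt_cat IHw; congr (_ * _).
by case: x => [[] []]; rewrite /letter_image /letter_ev //= elt_inv.
Qed.

Lemma fixed_testP u v w : fixed_test u v w ->
  conjugate (ev (elt u) (elt v) (elt w)) (elt w).
Proof.
case/hasP=> x _; rewrite elt_reduce elt_cat_conj elt_subst => /eqP E; rewrite -{2}E.
exact: conjugateJ.
Qed.

Lemma fixed_test_cred u v r : cred r ->
  conjugate (ev (elt u) (elt v) (elt r)) (elt r) -> fixed_test u v r.
Proof.
move=> cr /conjugate_sym[x Ex]; rewrite -[x]eltK in Ex.
have [s [y [/rotationP[p [q [Er Es]]] red E]]] := conj_cred_form x cr.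
apply/hasP; exists (inv_word (p ++ y)).
  rewrite mem_words_upto size_inv_word !size_cat leq_add //.
    by rewrite Er size_cat leq_addr.
  have -> : reduce (subst u v r) = inv_word y ++ s ++ y.
    by rewrite -(wval_elt red) -E -Ex -elt_subst.
  by rewrite !size_cat; lia.
rewrite elt_reduce elt_cat_conj elt_subst Ex E elt_cat_conj Es (elt_catC p) -Er.
by rewrite elt_inv elt_cat -[(_ ^ elt p) ^ elt y]conjgM conjgK.
Qed.

Lemma elt_flatten_const z (x : word) :
  elt (flatten [seq z | _ <- x]) = elt z ^+ size x.
Proof. by rewrite -elt_flatten_nseq; congr (elt (flatten _)); elim: x => //= _ x ->. Qed.

Lemma power_testP w : reflect (proper_power (elt w)) (power_test w).
Proof.
apply: (iffP hasP) => [[z _ /hasP[x _]]|[g [p [p1 E]]]].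
  case: ifP => // x1; rewrite elt_reduce elt_flatten_const => /eqP E.
  by exists (elt z), (size x); split=> //; case: x x1 {E} => [|a []].
(* For the identity [size_expg] gives no bound on the exponent; exponent 2 is taken instead. *)
have [g1|g1] := eqVneq g 1.
  exists [::]; first by rewrite mem_words_upto.
  apply/hasP; exists [:: (false, false); (false, false)].
    by rewrite mem_words_upto.
  by rewrite elt_reduce elt_flatten_const E g1 elt0 !expg1n.
have [sg sp] := size_expg g1 (ltnW p1); rewrite -E in sg sp.
have le := size_elt w.
exists (wval g); first by rewrite mem_words_upto /=; lia.
apply/hasP; exists (nseq p (false, false)).
  by rewrite mem_words_upto size_nseq /=; lia.
rewrite elt_reduce elt_flatten_const size_nseq eltK E eqxx.
by case: p p1 {E sg sp} => [|[]].
Qed.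

Lemma proper_power_conj g h : conjugate g h -> proper_power g -> proper_power h.
Proof.
by case=> x -> [w [p [p1 ->]]]; exists (w ^ x), p; rewrite conjXg.
Qed.

Lemma maximal_fixed_bound A B r : injective (ev A B) ->
  ~ (forall y : F2, exists x : F2, ev A B x = y) ->
  cred r -> conjugate (ev A B (elt r)) (elt r) -> ~ proper_power (elt r) ->
  (size r <= size A + size B + 1)%N.
Proof.
move=> inj nsurj cr fr npow.
have [s [t [k [b E]]]] := fixed_primitive_power inj nsurj cr fr.
(* Exponent 0 gives 1 = 1^2 and exponents above 1 are proper powers, so only exponent 1 remains. *)
have Es : elt r = s.
  case: k E => [|[|k]] E //; case: npow; last by exists s, k.+2.
  by exists 1, 2%N; rewrite E expg1n.
rewrite -Es in b.
have [neq|Mid] := pselect (exists c g, expo c (ev A B g) != expo c g).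
  exact: fixed_bound_nonid b cr (conjugate_refl _) fr neq.
have le : (size r <= size A + size B)%N.
  apply: fixed_bound_id nsurj _ b cr fr => // c g.
  by apply/eqP; apply/negPn/negP => neq; apply: Mid; exists c, g.
by rewrite (leq_trans le) ?leq_addr.
Qed.

Local Close Scope group_scope.
Local Open Scope classical_set_scope.

Theorem theorem3 :
  exists A : murec 1,
    forall (psi : {multiplicative F2 -> F2}) (u v : word),
      injective psi ->
      ~ (forall y : F2, exists x : F2, psi x = y) ->
      elt u = psi gen_a -> elt v = psi gen_b ->
      exists L : seq word,
        eval A [tuple words_code [:: u; v]] (words_code L) /\
        [set C | exists w : word, w \in L /\ C = conj_class (elt w)]
          = maximal_outer_fixed_points psi.
Proof.
have [A AE] := algorithm_murec.
exists A => psi u v inj nsurj Eu Ev; exists (algorithm [:: u; v]); split=> //.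
have psiE : psi =1 ev (elt u) (elt v) by apply: ev_unique => //; exact: gmulfM.
have mem w : w \in algorithm [:: u; v] =
    [&& ~~ power_test w, fixed_test u v w & size w <= (size u + size v).+1].
  by rewrite mem_filter mem_words_upto /= size_cat; case: power_test.
apply/seteqP; split=> C /=.
  case=> w [+ ->]; rewrite mem => /and3P[/power_testP npow /fixed_testP fw _].
  by exists (elt w); split=> //; split=> //; rewrite /outer_fixed_element psiE.
case=> w [[fw npow] ->].
(* The length bound and the completeness of [fixed_test] concern cyclically reduced words, so the
   class is represented by such a word. *)
have [r [y [cr _ rw]]] := exists_cred (wvalP w); rewrite eltK in rw.
have fr : conjugate (ev (elt u) (elt v) (elt r)) (elt r).
  apply: conjugate_trans (conjugate_ev _ _ rw) _.
  by rewrite -psiE; apply: conjugate_trans fw (conjugate_sym rw).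
have npr : ~ proper_power (elt r) by move/(proper_power_conj rw).
exists r; split; last by apply/conj_classP; exact: conjugate_sym.
rewrite mem; apply/and3P; split; first by apply/power_testP.
  exact: fixed_test_cred.
(* The bound refers to the reduced forms, which are no longer than the input words. *)
suff le : size r <= size (elt u) + size (elt v) + 1.
  by rewrite (leq_trans le) // addn1 ltnS leq_add // size_elt.
apply: maximal_fixed_bound cr fr npr.
  by move=> x x'; rewrite -!psiE; exact: inj.
by move=> surj; apply: nsurj => x; have [x' Ex] := surj x; exists x'; rewrite psiE.
Qed.
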